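(* Let $N=3$ and let $u=u_{\beta_0}$ be the separatrix solution of $\Delta^2u=e^u$ in $\mathbb{R}^3$ (defined in the context). Then there exists a constant $c>0$ such that, as $r\to\infty$, $$u_{\beta_0}(r)=\alpha_1 r+\alpha_2+\alpha_3 r^{-1}+O(e^{-cr}),$$ where $$\alpha_1=\frac{-1}{8\pi}\int_{\mathbb{R}^3}e^{u_{\beta_0}}\,dx,\qquad \alpha_2=\frac{1}{8\pi}\int_{\mathbb{R}^3}|x|\,e^{u_{\beta_0}}\,dx,\qquad \alpha_3=\frac{-1}{24\pi}\int_{\mathbb{R}^3}|x|^2e^{u_{\beta_0}}\,dx.$$
   Context: For $\beta\in\mathbb{R}$, let $u_\beta$ denote the unique smooth radial solution $u_\beta=u_\beta(r)$, $r=|x|$, $x\in\mathbb{R}^N$ (here $N=3$), of $$\Delta^2u_\beta=e^{u_\beta}\ \text{ for } r\in[0,R(\beta)),\qquad u_\beta(0)=0,\quad \Delta u_\beta(0)=\beta,\quad u_\beta'(0)=(\Delta u_\beta)'(0)=0,$$ where $[0,R(\beta))$ is the maximal interval of existence and, for a radial function $g$, $\Delta g=g''+\frac{N-1}{r}g'$. It is known that for $N\ge 3$ there is a (unique) number $\beta_0\in(-\infty,0)$, depending on $N$, such that $R(\beta)=+\infty$ for all $\beta\le\beta_0$, and $R(\beta)<\infty$ with $\lim_{r\nearrow R(\beta)}u_\beta(r)=\infty$ for all $\beta>\beta_0$. The solution $u_{\beta_0}$ is called the separatrix; it is identified with the radial function $x\mapsto u_{\beta_0}(|x|)$. For $N=3$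 it is known that there is $C>0$ with $u_{\beta_0}(r)\le -Cr$ for all $r$ large (so the integrals in the claim are finite). *)

(* Defs.v *)
From HB Require Import structures.
From mathcomp Require Import all_boot all_order all_algebra.
From mathcomp Require Import all_classical all_reals all_analysis.

Set Implicit Arguments.
Unset Strict Implicit.
Unset Printing Implicit Defensive.

Import Order.TTheory GRing.Theory Num.Theory.
Import numFieldNormedType.Exports.

Local Open Scope classical_set_scope.
Local Open Scope ring_scope.

(* A radial function x |-> g(|x|) on a ball of R^N centred at 0 is represented
   by its profile g, extended to negative arguments as an even function; it is
   smooth on the ball of radius Rb iff the even profile is smooth on ]-Rb, Rb[.
   The radius is in \bar R, so that Rb = +oo is allowed. *)
Definition smooth_radial (R : realType) (Rb : \bar R) (g : R -> R) : Prop :=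
  (forall r : R, (`|r|%:E < Rb)%E -> g (- r) = g r) /\
  (forall (k : nat) (r : R), (`|r|%:E < Rb)%E -> derivable (derive1n k g) r 1).

(* At the origin the quotient g'(r) / r is read as its limit g''(0), so that the
   value there is N g''(0), the Laplacian of x |-> g(|x|) at 0. *)
Definition radial_laplacian (R : realType) (N : nat) (g : R -> R) (r : R) : R :=
  if r == 0 then N%:R * derive1n 2 g 0
  else derive1n 2 g r + (N%:R - 1) / r * derive1 g r.

Definition radial_solution (R : realType) (N : nat) (beta : R) (Rb : \bar R)
    (u : R -> R) : Prop :=
  let Lap := @radial_laplacian R N in
  [/\ (0 < Rb)%E,
      smooth_radial Rb u,
      forall r : R, 0 <= r -> (r%:E < Rb)%E -> Lap (Lap u) r = expR (u r) &
      [/\ u 0 = 0, Lap u 0 = beta, derive1 u 0 = 0 & derive1 (Lap u) 0 = 0]].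

Definition maximal_radial_solution (R : realType) (N : nat) (beta : R)
    (Rb : \bar R) (u : R -> R) : Prop :=
  radial_solution N beta Rb u /\
  forall (Rb' : \bar R) (w : R -> R), radial_solution N beta Rb' w ->
    (forall r : R, 0 <= r -> (r%:E < Rb)%E -> (r%:E < Rb')%E -> w r = u r) ->
    (Rb' <= Rb)%E.

(* [u beta] and [Rmax beta] stand for u_beta and R(beta). *)
Definition separatrix_parameter (R : realType) (Rmax : R -> \bar R)
    (u : R -> R -> R) (beta0 : R) : Prop :=
  [/\ beta0 < 0,
      forall beta : R, beta <= beta0 -> Rmax beta = +oo%E &
      forall beta : R, beta0 < beta ->
        exists2 Rb : R, Rmax beta = Rb%:E & u beta r @[r --> Rb^'-] --> +oo].

(* R^3 is R * R * R; the norm `|x| on this product type is the sup norm, hence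
   an explicit Euclidean norm. *)
Definition enorm3 (R : realType) (x : R * R * R) : R :=
  Num.sqrt (x.1.1 ^+ 2 + x.1.2 ^+ 2 + x.2 ^+ 2).

Definition lebesgue3 (R : realType) :=
  ((@lebesgue_measure R \x @lebesgue_measure R) \x @lebesgue_measure R)%E.

Definition exp_moment3 (R : realType) (k : nat) (u : R -> R) : \bar R :=
  (\int[@lebesgue3 R]_x (enorm3 x ^+ k * expR (u (enorm3 x)))%:E)%E.

(* Main.v *)
Require Import Defs.
From HB Require Import structures.
From mathcomp Require Import all_boot all_order all_algebra.
From mathcomp Require Import all_classical all_reals all_analysis.
From mathcomp Require Import measurable_realfun ring lra.

Set Implicit Arguments.
Unset Strict Implicit.
Unset Printing Implicit Defensive.

Import Order.TTheory GRing.Theory Num.Theory.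
Import numFieldNormedType.Exports.

Local Open Scope classical_set_scope.
Local Open Scope ring_scope.

(** Multiplication by [r] conjugates the Laplacian of radial functions on R^3 to
    the second derivative on the half-line: with [v = r u], the equation becomes
    [v'''' = r e^u], with [v = v' = v'' = 0] and [v''' = beta] at the origin
    ([rlift k u] is the [k]-th derivative of [v]). As [v''''] is positive, [v''']
    increases, and two facts about the separatrix have to be shown:
    [v''' <= 0], and [v''' -> 0] at infinity.

    - A positive value of [v'''] at some point makes [v] grow like [r^3]; then
      [v'''' >= v^2] and [v] lies above an explicit function that blows up in
      finite time ([quartic_blowup]). The separatrix is global, so [v''' <= 0].
    - If [v'''] stayed below [- eta < 0], then [u <= - eta r^2 / 6]. Under this
      Gaussian bound for [e^u] a Gronwall argument shows that the solutions for
      slightly larger parameters stay negative as well ([perturbation_le0]),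
      although they should tend to [+oo]. Hence [v''' -> 0].
    - The quantity [r v''' - v''], which is the integral of [s^2 e^u] over [[0, r]],
      is increasing and positive; with [v''' <= 0] this bounds [v''] above by a
      negative constant for [r >= 1], and so [u <= - c r + O(1)]
      ([linear_decay]).

    The moments [m_k(r)], the integrals of [s^(k+2) e^u] over [[0, r]], are
    combinations of [v, ..., v'''] with coefficients that are powers of [r].
    Eliminating the derivatives gives the exact identity
    [6 r u = r^3 v''' - 3 r^2 m_0 + 3 r m_1 - m_2], in which [v'''] and the tails of
    the moments decay exponentially. This is the expansion, with coefficients
    [- m_0 / 2], [m_1 / 2] and [- m_2 / 6] evaluated at infinity
    ([separatrix_expansion]).

    It remains to recognise [4 pi m_k] at infinity as the integral of [|x|^k e^u]
    over R^3. The volume [4 pi r^3 / 3] of the ball comes from Tonelli's theorem,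
    and the integral of [h(|x|)] over the ball of radius [r] is squeezed between
    values of [h] on thin shells, so that it has derivative [4 pi r^2 h(r)]
    ([integral_radial]). *)

(** * Monotonicity, continuity induction and the exponential *)

Lemma is_derive_continuous (R : realType) (f : R -> R) (x df : R) :
  is_derive x 1 f df -> {for x, continuous f}.
Proof. by move=> [dfx _]; exact/differentiable_continuous/derivable1_diffP. Qed.

Lemma derive_ge0_le (R : realType) (f df : R -> R) (a b : R) :
  a <= b ->
  (forall x, a <= x <= b -> {for x, continuous f}) ->
  (forall x, a < x < b -> is_derive x 1 f (df x)) ->
  (forall x, a < x < b -> 0 <= df x) -> f a <= f b.
Proof.
move=> ab cf dfE df0.
have [b'|b'|<-//] := ltgtP a b; last by rewrite leNgt b' in ab.
have dfE' x : x \in `]a, b[ -> is_derive x 1 f (df x).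
  by rewrite in_itv /= => /dfE.
have cf' : {within `[a, b], continuous f}.
  apply: continuous_in_subspaceT => x /[!inE] /=; rewrite in_itv /= => xab.
  exact: cf.
have [c cab E] := MVT b' dfE' cf'.
rewrite -subr_ge0 E mulr_ge0 ?subr_ge0 ?(ltW b')// df0//.
Qed.

Lemma derive_le0_ge (R : realType) (f df : R -> R) (a b : R) :
  a <= b ->
  (forall x, a <= x <= b -> {for x, continuous f}) ->
  (forall x, a < x < b -> is_derive x 1 f (df x)) ->
  (forall x, a < x < b -> df x <= 0) -> f b <= f a.
Proof.
move=> ab cf dfE df0; rewrite -lerN2.
apply: (@derive_ge0_le _ (\- f) (\- df) _ _ ab) => x xab /=.
- exact: continuousN (cf x xab).
- exact: is_deriveN (dfE x xab).
- by rewrite oppr_ge0 df0.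
Qed.

Lemma derive_gt0_lt (R : realType) (f df : R -> R) (a b : R) :
  a < b ->
  (forall x, a <= x <= b -> {for x, continuous f}) ->
  (forall x, a < x < b -> is_derive x 1 f (df x)) ->
  (forall x, a < x < b -> 0 < df x) -> f a < f b.
Proof.
move=> ab cf dfE df0.
have dfE' x : x \in `]a, b[ -> is_derive x 1 f (df x).
  by rewrite in_itv /= => /dfE.
have cf' : {within `[a, b], continuous f}.
  apply: continuous_in_subspaceT => x /[!inE] /=; rewrite in_itv /= => xab.
  exact: cf.
have [c cab E] := MVT ab dfE' cf'.
by rewrite -subr_gt0 E mulr_gt0 ?subr_gt0// df0.
Qed.

(** A first-exit principle: the set of times up to which [f] stays positive is
    closed by the last hypothesis and open by continuity. It carries the
    bootstrap arguments in the comparison lemmas below. *)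
Lemma continuity_induction (R : realType) (f : R -> R) (a b : R) :
  (forall x, a <= x < b -> {for x, continuous f}) -> 0 < f a ->
  (forall t, a < t < b -> (forall s, a <= s < t -> 0 < f s) -> 0 < f t) ->
  forall t, a <= t < b -> 0 < f t.
Proof.
move=> cf fa step t /andP[at_ tb].
pose S := [set s | a <= s <= t /\ forall s', a <= s' <= s -> 0 < f s'].
have Sa : S a.
  split; first by rewrite lexx.
  by move=> s' /andP[h1 h2]; have -> : s' = a by apply/le_anti; rewrite h1 h2.
have Sub : ubound S t by move=> s [/andP[]].
have hsS : has_sup S by split; [exists a|exists t].
pose m := sup S.
have am : a <= m by apply: sup_upper_bound.
have mt : m <= t by apply: ge_sup => //; exists a.
have mb : m < b by exact: le_lt_trans tb.
have below s : a <= s < m -> 0 < f s.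
  move=> /andP[as_ sm].
  have [|s1 Ss1 h] := @sup_adherent _ S (m - s) _ hsS; first by rewrite subr_gt0.
  rewrite -/m opprB addrCA subrr addr0 in h.
  by case: Ss1 => _; apply; rewrite as_ ltW.
have fm : 0 < f m.
  move: am; rewrite le_eqVlt => /predU1P[<-//|am]; apply: step => //.
  by rewrite am.
have [<-//|mlt] : m = t \/ m < t.
  by move: mt; rewrite le_eqVlt => /predU1P[]; [left|right].
have cfm : {for m, continuous f} by apply: cf; rewrite am.
have : \forall x \near m, 0 < f x by apply: (cvgr_gt _ cfm).
move=> /nbhs_ballP[e /= e0 be].
pose s1 := Num.min t (m + e / 2).
have ms1 : m < s1 by rewrite /s1 lt_min mlt /= ltrDl divr_gt0.
have : S s1.
  split.
    by rewrite (le_trans am (ltW ms1)) /s1 ge_min lexx.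
  move=> s' /andP[as' s's1].
  have [s'm|ms'] := ltP s' m; first by apply: below; rewrite as'.
  apply: be; rewrite /ball /= distrC ger0_norm ?subr_ge0//.
  have : s' <= m + e / 2 by rewrite (le_trans s's1)// /s1 ge_min lexx orbT.
  by move: e0; lra.
move=> /(sup_upper_bound hsS); rewrite -/m => /le_lt_trans/(_ ms1).
by rewrite ltxx.
Qed.

(** The Taylor term of degree [k + 1] bounds [r ^ k] for [r >= 1]; the constant 1
    takes care of [r <= 1]. *)
Lemma exprn_le_expR (R : realType) (c : R) (k : nat) : 0 < c ->
  exists2 K : R, 0 < K & forall r, 0 <= r -> r ^+ k <= K * expR (c * r).
Proof.
move=> c0; exists (k.+1`!%:R / c ^+ k.+1 + 1).
  by rewrite ltr_pwDr// divr_ge0// ?exprn_ge0// ltW.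
move=> r r0.
have h := expR_ge1Dxn k (mulr_ge0 (ltW c0) r0).
have ck : 0 < c ^+ k.+1 by rewrite exprn_gt0.
have kk : 0 < k.+1`!%:R :> R by rewrite ltr0n fact_gt0.
have e1 : 1 <= expR (c * r).
  by rewrite (le_trans _ h)// lerDl divr_ge0 ?exprn_ge0 ?mulr_ge0// ltW.
have e2 : r ^+ k.+1 <= k.+1`!%:R / c ^+ k.+1 * expR (c * r).
  have -> : r ^+ k.+1 = k.+1`!%:R / c ^+ k.+1 * ((c * r) ^+ k.+1 / k.+1`!%:R).
    by rewrite exprMn; field; rewrite !gt_eqF.
  rewrite ler_wpM2l ?divr_ge0 ?(ltW ck) ?(ltW kk)//.
  by rewrite (le_trans _ h)// lerDr.
have [r1|r1] := leP r 1.
  rewrite (le_trans (exprn_ile1 _ r0 r1))// mulrDl mul1r.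
  by rewrite (le_trans e1)// lerDr mulr_ge0 ?expR_ge0// divr_ge0// ltW.
rewrite (@le_trans _ _ (r ^+ k.+1))//; first by rewrite ler_eXn2l.
by rewrite (le_trans e2)// ler_wpM2r ?expR_ge0// lerDl.
Qed.

(** * Reduction to a fourth-order equation on the half-line *)

(** The [k]-th derivative of [r |-> r * u r], by the Leibniz rule. In dimension
    three the radial Laplacian is conjugate to the second derivative through
    multiplication by [r], which removes the singular coefficient at 0. *)
Definition rlift (R : realType) (k : nat) (u : R -> R) (r : R) : R :=
  k%:R * derive1n k.-1 u r + r * derive1n k u r.

Lemma rlift0 (R : realType) (u : R -> R) (r : R) : rlift 0 u r = r * u r.
Proof. by rewrite /rlift mul0r add0r derive1n0. Qed.

Lemma smooth_is_derive (R : realType) (Rb : \bar R) (u : R -> R) (k : nat)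
    (r : R) : smooth_radial Rb u -> (`|r|%:E < Rb)%E ->
  is_derive r 1 (derive1n k u) (derive1n k.+1 u r).
Proof.
move=> [_ du] rRb; rewrite derive1nS derive1E.
by apply: DeriveDef => //; exact: du.
Qed.

Lemma is_derive_rlift (R : realType) (Rb : \bar R) (u : R -> R) (k : nat)
    (r : R) : smooth_radial Rb u -> (`|r|%:E < Rb)%E ->
  is_derive r 1 (rlift k u) (rlift k.+1 u r).
Proof.
move=> su rRb.
have d1 := smooth_is_derive k.-1 su rRb.
have d2 := smooth_is_derive k su rRb.
rewrite /rlift.
apply: is_derive_eq; rewrite /GRing.scale /= -natr1.
by case: k {d1 d2} => [|k] /=; ring.
Qed.

Lemma is_derive_div_id (R : realType) (f : R -> R) (df x : R) : x != 0 ->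
  is_derive x 1 f df ->
  is_derive x 1 (fun s => f s / s) (df / x - f x / x ^+ 2).
Proof.
move=> x0 dfx.
have dV : is_derive x 1 (fun s : R => s^-1) (- x ^- 2 *: 1).
  exact: is_deriveV.
apply: is_derive_eq; rewrite /GRing.scale /=.
by field.
Qed.

(** Away from the origin [Lap u = (r u)'' / r], and the same identity applied to
    [Lap u] gives [Lap (Lap u) = (r u)'''' / r]. *)
Lemma rlift_equation (R : realType) (beta : R) (Rb : \bar R) (u : R -> R)
    (r : R) : radial_solution 3 beta Rb u -> 0 < r -> (r%:E < Rb)%E ->
  rlift 4 u r = r * expR (u r).
Proof.
move=> [_ su eqn _] r0 rRb; rewrite -eqn ?ltW//.
have r_neq0 : r != 0 by rewrite gt_eqF.
have near_pos (s : R) : 0 < s -> \forall t \near s, 0 < t.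
  by move=> s0; exact: lt_nbhsr.
have near_Rb (s : R) : 0 < s -> (s%:E < Rb)%E ->
    \forall t \near s, 0 < t /\ (t%:E < Rb)%E.
  move=> s0 sRb; near=> t; split; first by near: t; exact: lt_nbhsr.
  near: t; case: Rb sRb {rRb su eqn} => [b||//] sRb; last first.
    by near=> t; rewrite ltry.
  by under eq_near do rewrite lte_fin; exact: lt_nbhsl.
have LapE (s : R) : 0 < s -> radial_laplacian 3 u s = rlift 2 u s / s.
  move=> s0; rewrite /radial_laplacian gt_eqF// /rlift /=.
  by field; rewrite gt_eqF.
have d1Lap (s : R) : 0 < s -> (s%:E < Rb)%E ->
    is_derive s 1 (radial_laplacian 3 u) (rlift 3 u s / s - rlift 2 u s / s ^+ 2).
  move=> s0 sRb; apply: (@near_eq_is_derive _ _ _ (fun t => rlift 2 u t / t)).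
    by near=> t; rewrite LapE//; near: t; exact: near_pos.
  apply: is_derive_div_id; first by rewrite gt_eqF.
  by apply: is_derive_rlift su _; rewrite gtr0_norm.
have d2Lap : is_derive r 1 (derive1 (radial_laplacian 3 u))
    (rlift 4 u r / r - 2 * rlift 3 u r / r ^+ 2 + 2 * rlift 2 u r / r ^+ 3).
  apply: (@near_eq_is_derive _ _ _
    (fun t => rlift 3 u t / t - rlift 2 u t / t / t)).
    near=> t.
    have [t0 tRb] : 0 < t /\ (t%:E < Rb)%E by near: t; exact: near_Rb.
    rewrite derive1E (@derive_val _ _ _ _ _ _ _ (d1Lap _ t0 tRb)).
    move: (rlift 3 u t) (rlift 2 u t) => A B.
    by field; rewrite gt_eqF.
  have rRb' : (`|r|%:E < Rb)%E by rewrite gtr0_norm.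
  have e1 := is_derive_div_id r_neq0 (is_derive_rlift 3 su rRb').
  have e2 := is_derive_div_id r_neq0
    (is_derive_div_id r_neq0 (is_derive_rlift 2 su rRb')).
  apply: is_derive_eq.
  by move: (rlift 4 u r) (rlift 3 u r) (rlift 2 u r) => A B C; field.
rewrite {1}/radial_laplacian (negbTE r_neq0) /=.
rewrite derive1E (@derive_val _ _ _ _ _ _ _ d2Lap).
rewrite derive1E (@derive_val _ _ _ _ _ _ _ (d1Lap _ r0 rRb)).
by move: (rlift 4 u r) (rlift 3 u r) (rlift 2 u r) => A B C; field.
Unshelve. all: end_near.
Qed.

Lemma rlift_initial (R : realType) (beta : R) (Rb : \bar R) (u : R -> R) :
  radial_solution 3 beta Rb u ->
  [/\ rlift 0 u 0 = 0, rlift 1 u 0 = 0, rlift 2 u 0 = 0 & rlift 3 u 0 = beta].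
Proof.
move=> [_ _ _ [u0 lu0 du0 _]]; rewrite /rlift !mul0r !addr0; split => //=.
- by rewrite u0 mulr0.
- by rewrite du0 mulr0.
- by rewrite -lu0 /radial_laplacian eqxx.
Qed.

Opaque rlift.

(** * Finite-time blow-up *)

Lemma is_derive_exprn (R : realType) (f : R -> R) (x df : R) (n : nat) :
  is_derive x 1 f df ->
  is_derive x 1 (fun s => f s ^+ n) (n%:R * f x ^+ n.-1 * df).
Proof.
move=> dfx; rewrite (_ : (fun s => f s ^+ n) = f ^+ n).
  by apply: is_derive_eq.
by apply/funext => s; rewrite exprfctE.
Qed.

(** One integration of a power lower bound; half of the constant absorbs the
    initial value. *)
Lemma power_growth (R : realType) (f df : R -> R) (n : nat) (k a : R) :
  (forall r : R, 0 <= r -> is_derive r 1 f (df r)) -> 0 < k -> 0 <= a ->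
  (forall r, a <= r -> k * r ^+ n <= df r) ->
  exists k' b, [/\ 0 < k', a <= b & forall r, b <= r -> k' * r ^+ n.+1 <= f r].
Proof.
move=> dfE k0 a0 dfge.
pose k' := k / n.+1%:R / 2.
have k'0 : 0 < k' by rewrite !divr_gt0.
pose g r := f r - k / n.+1%:R * r ^+ n.+1.
have dg (r : R) : 0 <= r -> is_derive r 1 g (df r - k * r ^+ n).
  move=> r0; have d1 := dfE _ r0.
  have d2 := is_derive_exprn n.+1 (is_derive_id r 1).
  apply: (is_derive_eq (is_deriveB d1 (is_deriveZ (k / n.+1%:R) d2))).
  by rewrite /GRing.scale /= mulr1 mulrA divfK// pnatr_eq0.
exists k', (a + 1 + `|g a| / k'); split => //.
  by rewrite -addrA lerDl addr_ge0// divr_ge0// ltW.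
move=> r br.
have h0 : 0 <= `|g a| / k' by rewrite divr_ge0// ltW.
have ar : a <= r by lra.
have r1 : 1 <= r by lra.
have gr : g a <= g r.
  apply: (@derive_ge0_le _ _ (fun s => df s - k * s ^+ n)) => //.
  - move=> x /andP[ax _]; apply: is_derive_continuous (dg x _).
    exact: le_trans ax.
  - by move=> x /andP[ax _]; apply: dg; rewrite (le_trans a0)// ltW.
  - by move=> x /andP[ax _]; rewrite subr_ge0 dfge// ltW.
have h1 : `|g a| <= k' * r ^+ n.+1.
  rewrite mulrC -ler_pdivrMr// (@le_trans _ _ r)//; first by lra.
  by rewrite -[leLHS]expr1 ler_weXn2l.
have h2 : - g a <= `|g a| by rewrite ler_normr lexx orbT.
have e : k / n.+1%:R = k' + k' by rewrite /k' -splitr.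
move: gr; rewrite {2}/g e; lra.
Qed.

Lemma is_derive_inv_sub_exp (R : realType) (T x : R) (n : nat) : x < T ->
  is_derive x 1 (fun t => (T - t)^-1 ^+ n) (n%:R * (T - x)^-1 ^+ n.+1).
Proof.
move=> xT.
have h0 : T - x != 0 by rewrite subr_eq0 gt_eqF.
have h1 : is_derive x 1 (fun t => T - t) (-1).
  apply: (is_derive_eq (is_deriveB (is_derive_cst T x 1) (is_derive_id x 1))).
  by rewrite sub0r.
have h2 := @is_deriveV R (fun t => T - t) x (-1) 1 h0 h1.
apply: (is_derive_eq (is_derive_exprn n h2)).
case: n => [|n]; first by rewrite !mul0r.
by rewrite /GRing.scale /= mulrNN mulr1 -exprVn -mulrA -exprD addn2.
Qed.

(** The function [B t = 840 / (T - t) ^ 4] solves [B'''' = B ^ 2] and blows up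
    at [T]. For [T] large it starts below [X1] together with its first three
    derivatives, and then it stays below [X1]. *)
Lemma quartic_blowup (R : realType) (X1 X2 X3 X4 F : R -> R) (a : R) :
  (forall r : R, a <= r -> is_derive r 1 X1 (X2 r)) ->
  (forall r : R, a <= r -> is_derive r 1 X2 (X3 r)) ->
  (forall r : R, a <= r -> is_derive r 1 X3 (X4 r)) ->
  (forall r : R, a <= r -> is_derive r 1 X4 (F r)) ->
  (forall r, a <= r -> X1 r ^+ 2 <= F r) ->
  [/\ 0 < X1 a, 0 < X2 a, 0 < X3 a & 0 < X4 a] -> False.
Proof.
move=> d1 d2 d3 d4 FX [X1a X2a X3a X4a].
pose m := Num.min (Num.min (X1 a) (X2 a)) (Num.min (X3 a) (X4 a)).
have m0 : 0 < m by rewrite !lt_min X1a X2a X3a X4a.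
have mX1 : m <= X1 a by rewrite !ge_min lexx.
have mX2 : m <= X2 a by rewrite !ge_min lexx !orbT.
have mX3 : m <= X3 a by rewrite !ge_min lexx !orbT.
have mX4 : m <= X4 a by rewrite !ge_min lexx !orbT.
(* Only [c * c = 840 c] and [1 <= c] matter: 840 = 4 * 5 * 6 * 7 makes
   [c (T - t)^-4] a solution of [B'''' = B ^ 2]. *)
pose c : R := 840.
have c1 : 1 <= c by rewrite ler1n.
have cc : c * c = 840 * c by [].
move: c c1 cc => c c1 cc.
have c0 : 0 < c by lra.
(* [tau = (T - a)^-1] is so small that [120 c tau], which dominates [B] and its
   first three derivatives at [a], lies below all four initial values. *)
pose tau := Num.min 1 (m / 240 / c).
have tau0 : 0 < tau by rewrite lt_min ltr01 divr_gt0//; lra.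
have tau1 : tau <= 1 by rewrite ge_min lexx.
have taum : tau * c <= m / 240.
  by rewrite -ler_pdivlMr// ge_min lexx orbT.
pose T := a + tau^-1.
have aT : a < T by rewrite ltrDl invr_gt0.
pose b n t := (T - t)^-1 ^+ n.
have ba n : (0 < n)%N -> c * b n a <= m / 240.
  case: n => // n _; rewrite mulrC (le_trans _ taum)// ler_wpM2r ?(ltW c0)// /b /T addrAC subrr add0r invrK exprS.
  by rewrite ler_piMr// ?exprn_ile1// ltW.
pose z1 t := X1 t - c * b 4 t.
pose z2 t := X2 t - 4 * (c * b 5 t).
pose z3 t := X3 t - 20 * (c * b 6 t).
pose z4 t := X4 t - 120 * (c * b 7 t).
have [ba4 ba5 ba6 ba7] := And4 (ba 4 isT) (ba 5 isT) (ba 6 isT) (ba 7 isT).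
have z1a : 0 < z1 a by rewrite /z1; lra.
have z2a : 0 < z2 a by rewrite /z2; lra.
have z3a : 0 < z3 a by rewrite /z3; lra.
have z4a : 0 < z4 a by rewrite /z4; lra.
have dz1 (t : R) : a <= t < T -> is_derive t 1 z1 (z2 t).
  move=> /andP[at_ tT]; have h1 := d1 _ at_; have h2 := is_derive_inv_sub_exp 4 tT.
  rewrite /z1 /b; apply: is_derive_eq.
  by rewrite /GRing.scale /= /z2 /b; move: (X2 t) ((T - t)^-1) => A B; ring.
have dz2 (t : R) : a <= t < T -> is_derive t 1 z2 (z3 t).
  move=> /andP[at_ tT]; have h1 := d2 _ at_; have h2 := is_derive_inv_sub_exp 5 tT.
  rewrite /z2 /b; apply: is_derive_eq.
  by rewrite /GRing.scale /= /z3 /b; move: (X3 t) ((T - t)^-1) => A B; ring.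
have dz3 (t : R) : a <= t < T -> is_derive t 1 z3 (z4 t).
  move=> /andP[at_ tT]; have h1 := d3 _ at_; have h2 := is_derive_inv_sub_exp 6 tT.
  rewrite /z3 /b; apply: is_derive_eq.
  by rewrite /GRing.scale /= /z4 /b; move: (X4 t) ((T - t)^-1) => A B; ring.
have dz4 (t : R) : a <= t < T -> is_derive t 1 z4 (F t - (c * b 4 t) ^+ 2).
  move=> /andP[at_ tT]; have h1 := d4 _ at_; have h2 := is_derive_inv_sub_exp 7 tT.
  rewrite /z4 /b; apply: is_derive_eq.
  rewrite exprMn (expr2 c) cc /GRing.scale /= /b.
  by move: (F t) ((T - t)^-1) => A B; ring.
have incr (z dz : R -> R) t : a <= t < T ->
    (forall s : R, a <= s < T -> is_derive s 1 z (dz s)) ->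
    (forall s, a < s < t -> 0 <= dz s) -> z a <= z t.
  move=> /andP[at_ tT] dz_ dz0; apply: (@derive_ge0_le _ _ dz) => //.
  - move=> x /andP[ax xt]; apply: is_derive_continuous (dz_ x _).
    by rewrite ax (le_lt_trans xt).
  - by move=> x /andP[ax xt]; apply: dz_; rewrite ltW//= (lt_trans xt).
have z1_gt0 : forall t, a <= t < T -> 0 < z1 t.
  apply: continuity_induction => //.
    by move=> x /dz1; exact: is_derive_continuous.
  move=> t /andP[at_ tT] z1pos.
  have sub s s' : a <= s' <= s -> s < t -> a <= s' < T.
    by move=> /andP[-> s's] st /=; rewrite (le_lt_trans s's)// (lt_trans st).
  have z4pos s : a <= s < t -> 0 <= z4 s.
    move=> /andP[as_ st]; rewrite (le_trans (ltW z4a))//.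
    apply: incr dz4 _; first by rewrite as_ (lt_trans st).
    move=> x /andP[ax xs].
    have axt : a <= x < t by rewrite ltW//= (lt_trans xs).
    rewrite subr_ge0 (le_trans _ (FX _ (ltW ax)))// ler_sqr ?nnegrE.
    - by rewrite -subr_ge0 ltW// -/(z1 x) z1pos.
    - rewrite mulr_ge0 ?(ltW c0)// exprn_ge0// invr_ge0 subr_ge0 ltW//.
      by rewrite (lt_trans xs)// (lt_trans st).
    - rewrite (@le_trans _ _ (c * b 4 x))//.
        rewrite mulr_ge0 ?(ltW c0)// exprn_ge0// invr_ge0 subr_ge0 ltW//.
        by rewrite (lt_trans xs)// (lt_trans st).
      by rewrite -subr_ge0 ltW// -/(z1 x) z1pos.
  have z3pos s : a <= s < t -> 0 <= z3 s.
    move=> /andP[as_ st]; rewrite (le_trans (ltW z3a))//.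
    apply: incr dz3 _; first by rewrite as_ (lt_trans st).
    by move=> x /andP[ax xs]; apply: z4pos; rewrite ltW//= (lt_trans xs).
  have z2pos s : a <= s < t -> 0 <= z2 s.
    move=> /andP[as_ st]; rewrite (le_trans (ltW z2a))//.
    apply: incr dz2 _; first by rewrite as_ (lt_trans st).
    by move=> x /andP[ax xs]; apply: z3pos; rewrite ltW//= (lt_trans xs).
  rewrite (lt_le_trans z1a)//; apply: incr dz1 _; first by rewrite ltW.
  by move=> x /andP[ax xs]; apply: z2pos; rewrite ltW.
have [M hM] : exists M, forall t, a <= t < T -> X1 t <= M.
  have cX1 : {within `[a, T], continuous X1}.
    apply: continuous_in_subspaceT => x /[!inE] /=; rewrite in_itv /= => /andP[ax _].
    by apply: is_derive_continuous (d1 _ ax).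
  have [xm _ hxm] := EVT_max (ltW aT) cX1.
  by exists (X1 xm) => t /andP[at_ tT]; apply: hxm; rewrite in_itv /= at_ ltW.
(* At distance [s] from [T], the lower bound [c s^-4] exceeds the maximum [M] of
   [X1] on [[a, T]]. *)
pose s := Num.min tau^-1 (1 + `|M|)^-1.
have s0 : 0 < s by rewrite lt_min !invr_gt0 tau0 ltr_pwDl.
have ats : a <= T - s < T.
  rewrite ltrBlDr ltrDl s0 andbT /T -addrA lerDl subr_ge0.
  by rewrite ge_min lexx.
have := z1_gt0 _ ats; rewrite /z1 subr_gt0 => /lt_le_trans/(_ (hM _ ats)).
rewrite /b opprB addrCA subrr addr0 => hlt.
have s1 : s <= (1 + `|M|)^-1 by rewrite ge_min lexx orbT.
have hi : 1 + `|M| <= s^-1.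
  by rewrite -[leLHS]invrK lef_pV2// posrE ?invr_gt0 ltr_pwDl.
have h4 : s^-1 <= s^-1 ^+ 4.
  rewrite -[leLHS]expr1 ler_weXn2l// (le_trans _ hi)// lerDl//.
have h5 : s^-1 ^+ 4 <= c * s^-1 ^+ 4.
  by rewrite ler_peMl// exprn_ge0// invr_ge0 ltW.
have := ler_norm M; have := normr_ge0 M; lra.
Qed.

(** A positive value of [(r u)'''] makes [r u] grow cubically, and then the
    exponential dominates the square. *)
Lemma global_rlift3_le0 (R : realType) (beta : R) (u : R -> R) :
  radial_solution 3 beta +oo u -> forall r, 0 <= r -> rlift 3 u r <= 0.
Proof.
move=> sol r0 r0ge; rewrite leNgt; apply/negP => X4pos.
have [_ su _ _] := sol.
have d k (r : R) : is_derive r 1 (rlift k u) (rlift k.+1 u r).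
  by apply: is_derive_rlift su _; rewrite ltry.
have X4ge r : r0 <= r -> rlift 3 u r0 * r ^+ 0 <= rlift 3 u r.
  move=> rr; rewrite expr0 mulr1.
  apply: (@derive_ge0_le _ (rlift 3 u) (rlift 4 u)) rr _ _ _.

  - by move=> x _; exact: is_derive_continuous (d _ _).
  - move=> x /andP[x0 _]; have xpos : 0 < x by rewrite (le_lt_trans r0ge).
    by rewrite (rlift_equation sol) ?ltry// mulr_ge0 ?expR_ge0// ltW.
have [k3 [r3 [k3pos r03 X3ge]]] := power_growth (fun r _ => d 2%N r) X4pos r0ge X4ge.
have [k2 [r2 [k2pos r32 X2ge]]] :=
  power_growth (fun r _ => d 1%N r) k3pos (le_trans r0ge r03) X3ge.
have [k1 [r1 [k1pos r21 X1ge]]] :=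
  power_growth (fun r _ => d 0%N r) k2pos (le_trans (le_trans r0ge r03) r32) X2ge.
(* Beyond [6 / k1], [u r >= k1 r ^ 2 >= 6 r], and then
   [r exp u >= r u ^ 3 / 6 >= (r u) ^ 2]. *)
pose a := r1 + 6 / k1 + 1.
have h6 : 0 <= 6 / k1 by rewrite divr_ge0// ltW.
have a1 : r1 <= a by rewrite /a; lra.
have apos : 0 < a by rewrite /a; lra.
apply: (@quartic_blowup _ (rlift 0 u) (rlift 1 u) (rlift 2 u) (rlift 3 u)
  (rlift 4 u) a).
- move=> r ar; have rpos : 0 < r by exact: lt_le_trans ar.
  rewrite (rlift_equation sol) ?ltry// rlift0.
  have := X1ge r (le_trans a1 ar); rewrite rlift0 => hu.
  have u6 : 6 * r <= u r.
    have : k1 * r ^+ 2 <= u r.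
      by rewrite -(ler_pM2l rpos) (le_trans _ hu)// !exprS; lra.
    apply: le_trans; rewrite expr2 mulrA ler_wpM2r ?(ltW rpos)//.
    rewrite mulrC -ler_pdivrMr// (le_trans _ ar)// /a; lra.
  have upos : 0 <= u r by rewrite (le_trans _ u6)// mulr_ge0// ltW.
  have hexp := expR_ge1Dxn 2 upos.
  rewrite exprMn expr2 -mulrA ler_wpM2l ?(ltW rpos)//.
  apply: le_trans hexp.
  have : r * u r ^+ 2 <= u r ^+ 3 / 6.
    rewrite ler_pdivlMr// [_ ^+ 3]exprS mulrAC ler_wpM2r ?sqr_ge0//; lra.
  rewrite (_ : (3`!)%:R = 6)//; lra.
- split.
  + by rewrite (lt_le_trans _ (X1ge _ a1))// mulr_gt0// exprn_gt0.
  + by rewrite (lt_le_trans _ (X2ge _ (le_trans r21 a1)))// mulr_gt0// exprn_gt0.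
  + by rewrite (lt_le_trans _ (X3ge _ (le_trans (le_trans r32 r21) a1)))// mulr_gt0// exprn_gt0.
  + rewrite (lt_le_trans _ (X4ge _ (le_trans (le_trans (le_trans r03 r32) r21) a1)))//.
    by rewrite expr0 mulr1.
Qed.

(** * Openness of the set of parameters with quadratic decay *)

Lemma triple_antiderivative_le (R : realType) (f0 f1 f2 f3 : R -> R) (M b : R) :
  (forall x : R, 0 <= x <= b -> is_derive x 1 f0 (f1 x)) ->
  (forall x : R, 0 <= x <= b -> is_derive x 1 f1 (f2 x)) ->
  (forall x : R, 0 <= x <= b -> is_derive x 1 f2 (f3 x)) ->
  f0 0 = 0 -> f1 0 = 0 -> f2 0 = 0 ->
  (forall x, 0 < x < b -> f3 x <= M) ->
  forall x, 0 <= x <= b -> f0 x <= M * (x ^+ 3 / 6).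
Proof.
move=> d0 d1 d2 f00 f10 f20 f3M.
have step (f df : R -> R) (p dp : R -> R) x : 0 <= x <= b ->
    (forall x : R, 0 <= x <= b -> is_derive x 1 f (df x)) ->
    (forall x : R, is_derive x 1 p (dp x)) -> f 0 = 0 -> p 0 = 0 ->
    (forall x, 0 < x < b -> df x <= M * dp x) -> f x <= M * p x.
  move=> /andP[x0 xb] df_ dp_ f0' p0 le.
  have dg y : 0 <= y <= b ->
      is_derive y 1 (fun y => M * p y - f y) (M * dp y - df y).
    by move=> /df_ dfy; exact: is_deriveB (is_deriveZ M (dp_ y)) dfy.
  suff : M * p 0 - f 0 <= M * p x - f x by rewrite p0 f0' mulr0 subr0 subr_ge0.
  apply: (@derive_ge0_le _ (fun y => M * p y - f y)
    (fun y => M * dp y - df y) _ _ x0) => y /andP[y0 yx].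
  - apply: is_derive_continuous (dg y _).
    by rewrite y0 (le_trans yx).
  - by apply: dg; rewrite ltW//= (le_trans (ltW yx)).
  - by rewrite subr_ge0 le// y0 (lt_le_trans yx).
have dpow (n : nat) (x : R) : is_derive x 1 (fun x => x ^+ n) (n%:R * x ^+ n.-1).
  by apply: is_derive_eq (is_derive_exprn n (is_derive_id x 1)) _; rewrite mulr1.
have f2le x : 0 <= x <= b -> f2 x <= M * x.
  move=> xb; apply: (step f2 f3 id (fun=> 1)) => //.
  by move=> y yb; rewrite mulr1 f3M.
have f1le x : 0 <= x <= b -> f1 x <= M * (x ^+ 2 / 2).
  move=> xb; apply: (step f1 f2 (fun x => x ^+ 2 / 2) id) => //.
  - move=> y; apply: (is_derive_eq (is_deriveM (dpow 2 y) (is_derive_cst (2^-1 : R) y 1))).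
    by rewrite /GRing.scale /=; field.
  - by rewrite /= expr0n mul0r.
  - by move=> y /andP[y0 yb]; apply: f2le; rewrite !ltW.
move=> x xb; apply: (step f0 f1 (fun x => x ^+ 3 / 6) (fun x => x ^+ 2 / 2)) => //.
- move=> y; apply: (is_derive_eq (is_deriveM (dpow 3 y) (is_derive_cst (6^-1 : R) y 1))).
  by rewrite /GRing.scale /=; field.
- by rewrite /= expr0n mul0r.
- by move=> y /andP[y0 yb]; apply: f1le; rewrite !ltW.
Qed.

Lemma triple_antiderivative_ge0 (R : realType) (f0 f1 f2 f3 : R -> R) (b : R) :
  (forall x : R, 0 <= x <= b -> is_derive x 1 f0 (f1 x)) ->
  (forall x : R, 0 <= x <= b -> is_derive x 1 f1 (f2 x)) ->
  (forall x : R, 0 <= x <= b -> is_derive x 1 f2 (f3 x)) ->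
  f0 0 = 0 -> f1 0 = 0 -> f2 0 = 0 ->
  (forall x, 0 < x < b -> 0 <= f3 x) ->
  forall x, 0 <= x <= b -> 0 <= f0 x.
Proof.
move=> d0 d1 d2 f00 f10 f20 f3M x xb.
rewrite -oppr_le0 -[leRHS](mul0r (x ^+ 3 / 6)).
apply: (@triple_antiderivative_le _ (\- f0) (\- f1) (\- f2) (\- f3) 0 b) => //=.
- by move=> y /d0; exact: is_deriveN.
- by move=> y /d1; exact: is_deriveN.
- by move=> y /d2; exact: is_deriveN.
- by rewrite f00 oppr0.
- by rewrite f10 oppr0.
- by rewrite f20 oppr0.
- by move=> y /f3M; rewrite oppr_le0.
Qed.

Lemma expR_sub_le (R : realType) (x y : R) :
  expR x - expR y <= (x - y) * expR x.
Proof.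
have := expR_ge1Dx (y - x); rewrite expRD expRN ler_pdivlMr ?expR_gt0//.
by move: (expR x) (expR y) => A B; lra.
Qed.

Lemma le_oppr_of_sub_le (R : realType) (x y z : R) :
  x - y <= z -> y <= - (2 * z) -> x <= - z.
Proof. lra. Qed.

(** Gronwall: let [D] be the difference of the third derivatives and [a = eta / 12].
    Then [u <= - 2 a r ^ 2], and as long as [D <= eta / 2] also [w - u <= a r ^ 2],
    so that [w <= - a r ^ 2] and [D' <= D * g'] for the bounded function
    [g r = - (a r ^ 2 + 1) / (12 a ^ 2) * exp (- a r ^ 2)], whose derivative is
    [r ^ 3 / 6 * exp (- a r ^ 2)]. The smallness hypothesis on [beta - beta0] then
    keeps [D] strictly below [eta / 2]. *)
Lemma perturbation_le0 (R : realType) (beta0 beta eta Rb : R) (u w : R -> R) :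
  radial_solution 3 beta0 +oo u -> radial_solution 3 beta Rb%:E w ->
  0 < eta -> (forall r, 0 <= r -> rlift 3 u r <= - eta) ->
  beta0 < beta ->
  (beta - beta0) * expR ((12 * (eta / 12) ^+ 2)^-1) < eta / 2 ->
  forall r, 0 < r < Rb -> w r <= 0.
Proof.
move=> solu solw eta0 ueta bb small.
have [_ su _ _] := solu; have [Rb0 sw _ _] := solw.
have [u0 u1 u2 u3] := rlift_initial solu; have [w0 w1 w2 w3] := rlift_initial solw.
pose D k r := rlift k w r - rlift k u r.
have dD k (r : R) : 0 <= r < Rb -> is_derive r 1 (D k) (D k.+1 r).
  move=> /andP[r0 rRb]; apply: is_deriveB.
    by apply: is_derive_rlift sw _; rewrite lte_fin ger0_norm.
  by apply: is_derive_rlift su _; rewrite ltry.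
have D00 : D 0 0 = 0 by rewrite /D u0 w0 subrr.
have D10 : D 1 0 = 0 by rewrite /D u1 w1 subrr.
have D20 : D 2 0 = 0 by rewrite /D u2 w2 subrr.
have D30 : D 3 0 = beta - beta0 by rewrite /D u3 w3.
have D0E r : D 0 r = r * (w r - u r) by rewrite /D !rlift0 mulrBr.
have D4E r : 0 < r < Rb -> D 4 r = r * (expR (w r) - expR (u r)).
  move=> /andP[r0 rRb]; rewrite /D (rlift_equation solw)//.
  by rewrite (rlift_equation solu) ?ltry// mulrBr.
have sub (t x : R) : t < Rb -> 0 <= x <= t -> 0 <= x < Rb.
  by move=> tRb /andP[-> xt]; rewrite (le_lt_trans xt).
have D0ge0 t : t < Rb -> (forall s, 0 <= s < t -> 0 < D 3 s) ->
    forall x, 0 <= x <= t -> 0 <= D 0 x.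
  move=> tRb pos.
  have pos' x : 0 < x < t -> 0 <= D 3 x.
    by move=> /andP[x0 xt]; rewrite ltW// pos// ltW.
  have dDt k (x : R) (xt : 0 <= x <= t) := dD k x (sub t x tRb xt).
  exact: (triple_antiderivative_ge0 (dDt 0%N) (dDt 1%N) (dDt 2%N) D00 D10 D20 pos').
have D4ge0 t : t < Rb -> (forall s, 0 <= s < t -> 0 < D 3 s) ->
    forall x, 0 < x < t -> 0 <= D 4 x.
  move=> tRb pos x /andP[x0 xt]; rewrite D4E ?x0 ?(lt_trans xt)//.
  rewrite mulr_ge0 ?(ltW x0)// subr_ge0 ler_expR -subr_ge0.
  have := D0ge0 t tRb pos x; rewrite D0E pmulr_rge0//; apply.
  by rewrite !ltW.
have D3incr t : t < Rb -> (forall s, 0 <= s < t -> 0 < D 3 s) ->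
    forall x y, 0 <= x -> x <= y -> y <= t -> D 3 x <= D 3 y.
  move=> tRb pos x y x0 xy yt; apply: (@derive_ge0_le _ (D 3) (D 4)) xy _ _ _.
  - move=> z /andP[xz zy]; apply: is_derive_continuous (dD _ _ _).
    by rewrite (le_trans x0)// (le_lt_trans zy)// (le_lt_trans yt).
  - move=> z /andP[xz zy]; apply: dD.
    by rewrite (le_trans x0 (ltW xz))// (lt_le_trans zy)// (le_trans yt)// ltW.
  - move=> z /andP[xz zy]; apply: D4ge0 tRb pos _ _.
    by rewrite (le_lt_trans x0 xz) (lt_le_trans zy).
have D3gt0 : forall t, 0 <= t < Rb -> 0 < D 3 t.
  apply: continuity_induction.
  - by move=> x /(dD 3%N); exact: is_derive_continuous.
  - by rewrite D30 subr_gt0.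
  - move=> t /andP[t0 tRb] pos; apply: (@lt_le_trans _ _ (D 3 0)).
      by rewrite D30 subr_gt0.
    by apply: D3incr tRb pos _ _ _ _ _; rewrite ?lexx ?ltW.
have pos t : t < Rb -> forall s, 0 <= s < t -> 0 < D 3 s.
  by move=> tRb s /andP[s0 st]; apply: D3gt0; rewrite s0 (lt_trans st).
pose a := eta / 12.
have a0 : 0 < a by rewrite divr_gt0.
have ule r : 0 < r -> u r <= - (2 * (a * r ^+ 2)).
  move=> r0.
  have : rlift 0 u r <= - eta * (r ^+ 3 / 6).
    have d k (x : R) (_ : 0 <= x <= r) : is_derive x 1 (rlift k u) (rlift k.+1 u x).
      by apply: is_derive_rlift su _; rewrite ltry.
    have le x : 0 < x < r -> rlift 3 u x <= - eta.
      by move=> /andP[x0 _]; apply: ueta; rewrite ltW.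
    apply: (triple_antiderivative_le (d 0%N) (d 1%N) (d 2%N) u0 u1 u2 le).
    by rewrite lexx ltW.
  have -> : - eta * (r ^+ 3 / 6) = r * (- (2 * (a * r ^+ 2))) by rewrite /a; field.
  by rewrite rlift0 ler_pM2l.
have D0le t M : t < Rb -> (forall s, 0 < s < t -> D 3 s <= M) -> 0 <= t ->
    D 0 t <= M * (t ^+ 3 / 6).
  move=> tRb le t0.
  have dDt k (x : R) (xt : 0 <= x <= t) := dD k x (sub t x tRb xt).
  apply: (triple_antiderivative_le (dDt 0%N) (dDt 1%N) (dDt 2%N) D00 D10 D20 le).
  by rewrite t0 lexx.
have diffle t : 0 < t < Rb -> (forall s, 0 < s < t -> D 3 s <= eta / 2) ->
    w t - u t <= a * t ^+ 2.
  move=> /andP[t0 tRb] le; have := D0le _ _ tRb le (ltW t0).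
  have -> : eta / 2 * (t ^+ 3 / 6) = t * (a * t ^+ 2) by rewrite /a; field.
  by rewrite D0E ler_pM2l.
pose g r := - ((a * r ^+ 2 + 1) / (12 * a ^+ 2) * expR (- (a * r ^+ 2))).
have dg (r : R) : is_derive r 1 g (r ^+ 3 / 6 * expR (- (a * r ^+ 2))).
  have e1 : is_derive r 1 (fun r => a * r ^+ 2) (2 * a * r).
    by apply: is_derive_eq; rewrite /GRing.scale /=; ring.
  have e2 : is_derive r 1 (fun r => expR (- (a * r ^+ 2)))
      (expR (- (a * r ^+ 2)) * - (2 * a * r)).
    by have e2' := is_deriveN e1; apply: is_derive1_comp.
  have e3 : is_derive r 1 (fun r => (a * r ^+ 2 + 1) / (12 * a ^+ 2))
      (2 * a * r / (12 * a ^+ 2)).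
    have e3' := is_deriveD e1 (is_derive_cst (1 : R) r 1).
    apply: is_derive_eq (is_deriveM e3' (is_derive_cst ((12 * a ^+ 2)^-1 : R) r 1)) _.
    by rewrite /GRing.scale /=; ring.
  apply: is_derive_eq (is_deriveN (is_deriveM e3 e2)) _.
  rewrite /GRing.scale /=; move: (expR _) => E; field.
  by rewrite gt_eqF.
have gle0 r : g r <= 0.
  rewrite oppr_le0 mulr_ge0 ?expR_ge0//.
  have h := ltW a0.
  have h2 : 0 <= a * r ^+ 2 by rewrite mulr_ge0 ?sqr_ge0.
  have h3 : 0 <= 12 * a ^+ 2 by rewrite mulr_ge0 ?sqr_ge0.
  by rewrite divr_ge0// addr_ge0.
have g0 : g 0 = - (12 * a ^+ 2)^-1.
  by rewrite /g expr0n mulr0 oppr0 expR0 add0r mulr1 mul1r.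
have D3lt : forall t, 0 <= t < Rb -> 0 < eta / 2 - D 3 t.
  have dP (x : R) : 0 <= x < Rb -> is_derive x 1 (fun x => eta / 2 - D 3 x) (- D 4 x).
    move=> /(dD 3%N) d.
    by apply: is_derive_eq (is_deriveB (is_derive_cst (eta / 2) x 1) d) _; rewrite sub0r.
  apply: continuity_induction.
  - by move=> x /dP; exact: is_derive_continuous.
  - rewrite D30 subr_gt0 (le_lt_trans _ small)// ler_peMr ?subr_ge0 ?(ltW bb)//.
    by rewrite -expR0 ler_expR invr_ge0 mulr_ge0 ?sqr_ge0.
  - move=> t /andP[t0 tRb] le.
    have D4le s : 0 < s < t -> D 4 s <= D 3 s * (s ^+ 3 / 6 * expR (- (a * s ^+ 2))).
      move=> /andP[s0 st]; have sRb := lt_trans st tRb.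
      have sin : 0 < s < Rb by rewrite s0.
      rewrite D4E//.
      have h1 : w s - u s <= a * s ^+ 2.
        apply: (diffle s sin) => x /andP[x0 xs]; rewrite -subr_ge0 ltW// le//.
        by rewrite ltW//= (lt_trans xs).
      have h2 : expR (w s) - expR (u s) <= (w s - u s) * expR (w s).
        exact: expR_sub_le.
      have h3 := le_oppr_of_sub_le h1 (ule _ s0).
      have h4 : 0 <= w s - u s.
        have := D0ge0 _ sRb (pos _ sRb) s; rewrite D0E pmulr_rge0//; apply.
        by rewrite lexx ltW.
      have h5 : D 0 s <= D 3 s * (s ^+ 3 / 6).
        apply: (D0le s _ sRb _ (ltW s0)) => x /andP[x0 xs].
        exact: (D3incr s sRb (pos s sRb) x s (ltW x0) (ltW xs) (lexx s)).
      rewrite (@le_trans _ _ (s * ((w s - u s) * expR (w s))))//.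
        by rewrite ler_pM2l.
      rewrite mulrA -D0E [in leRHS]mulrA ler_pM ?expR_ge0 ?ler_expR//.
      by rewrite D0E mulr_ge0// ltW.
    (* [phi' >= 0] is the differential form of Gronwall's inequality
       [(D * exp (- g))' <= 0]. *)
    pose phi s := - (D 3 s * expR (- g s)).
    have dphi (s : R) : 0 <= s < Rb -> is_derive s 1 phi
        ((D 3 s * (s ^+ 3 / 6 * expR (- (a * s ^+ 2))) - D 4 s) * expR (- g s)).
      move=> /(dD 3%N) d.
      have e2 : is_derive s 1 (fun r => expR (- g r))
          (expR (- g s) * - (s ^+ 3 / 6 * expR (- (a * s ^+ 2)))).
        by have e2' := is_deriveN (dg s); apply: is_derive1_comp.
      apply: is_derive_eq (is_deriveN (is_deriveM d e2)) _.
      rewrite /GRing.scale /=; move: (expR (- g s)) (expR _) (D 3 s) (D 4 s) => A B C E.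
      by ring.
    have : phi 0 <= phi t.
      have inRb s : 0 < s < t -> 0 <= s < Rb.
        by move=> /andP[s0 st]; rewrite ltW//= (lt_trans st).
      have dphi' s (st : 0 < s < t) := dphi s (inRb s st).
      apply: (@derive_ge0_le _ phi _ 0 t (ltW t0) _ dphi') => x xt.
        by apply: is_derive_continuous (dphi x _); exact: (sub t x tRb xt).
      by rewrite mulr_ge0 ?expR_ge0// subr_ge0 D4le.
    rewrite lerN2 D30 g0 (opprK (12 * a ^+ 2)^-1) -[a]/(eta / 12) => h.
    have h1 : 1 <= expR (- g t) by rewrite -expR0 ler_expR oppr_ge0 gle0.
    rewrite subr_gt0 (le_lt_trans _ small)// (le_trans _ h)//.
    apply: ler_peMr h1; apply: ltW; apply: D3gt0.
    by rewrite (ltW t0).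
move=> r rRb; have /andP[r0 _] := rRb.
have h1 : w r - u r <= a * r ^+ 2.
  apply: (diffle r rRb) => s /andP[s0 sr]; rewrite -subr_ge0 ltW// D3lt// ltW//=.
  by case/andP: rRb => _; exact: lt_trans.
have h2 := ule _ r0.
rewrite (le_trans (le_oppr_of_sub_le h1 h2))// oppr_le0.
by rewrite mulr_ge0 ?sqr_ge0// ltW.
Qed.
(** If [(r u)'''] stayed below a negative constant, the solutions for slightly
    larger parameters would remain bounded above. *)
Lemma separatrix_rlift3_sup (R : realType) (Rmax : R -> \bar R)
    (u : R -> R -> R) (beta0 : R) :
  (forall beta : R, maximal_radial_solution 3 beta (Rmax beta) (u beta)) ->
  separatrix_parameter Rmax u beta0 ->
  forall eta, 0 < eta -> exists2 r, 0 <= r & - eta < rlift 3 (u beta0) r.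
Proof.
move=> hu [_ glob blow] eta eta0; apply: contrapT => nex.
have ueta r : 0 <= r -> rlift 3 (u beta0) r <= - eta.
  by move=> r0; rewrite leNgt; apply/negP => h; apply: nex; exists r.
have [sol0 _] := hu beta0; rewrite glob// in sol0.
pose E := expR ((12 * (eta / 12) ^+ 2)^-1).
have E0 : 0 < E by exact: expR_gt0.
(* The Gronwall factor [E] times [beta - beta0] is [eta / 4 < eta / 2]. *)
pose beta := beta0 + eta / 4 / E.
have d0 : 0 < eta / 4 / E by rewrite !divr_gt0.
have bb : beta0 < beta by rewrite ltrDl.
have [Rb RbE cvgy] := blow _ bb.
have [solb _] := hu beta; rewrite RbE in solb.
have le0 : forall r, 0 < r < Rb -> u beta r <= 0.
  apply: (perturbation_le0 sol0 solb eta0 ueta bb).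
  by rewrite /beta addrC addKr -/E divfK ?gt_eqF//; lra.
have Rb0 : 0 < Rb by have [] := solb; rewrite lte_fin.
have /cvgryPgt/(_ 0) h := cvgy.
have : \forall r \near Rb^'-, False.
  near=> r.
  have r1 : 0 < r < Rb.
    by apply/andP; split; near: r; [exact: nbhs_left_gt|exact: nbhs_left_lt].
  have r2 : 0 < u beta r by near: r.
  by move: (le0 _ r1); rewrite leNgt r2.
by move=> /filter_ex[].
Unshelve. all: end_near.
Qed.

(** * Linear decay and the moments of the exponential *)

Lemma is_derive_sub_cst (R : realType) (x a : R) :
  is_derive x 1 (fun s => s - a) 1.
Proof.
apply: is_derive_eq (is_deriveB (is_derive_id x 1) (is_derive_cst a x 1)) _.
by rewrite subr0.
Qed.

(** The integral of [s ^ (k + 2) exp u] over [[0, r]] for [k <= 2], in closed form: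
    it is the integral of [s ^ (k + 1) v''''] with [v = r u], integrated by parts
    until only [v], ..., [v'''] remain. *)
Definition radial_moment (R : realType) (k : nat) (u : R -> R) (r : R) : R :=
  r ^+ k.+1 * rlift 3 u r - k.+1%:R * r ^+ k * rlift 2 u r
    + (k.+1 * k)%:R * (r ^+ k.-1 * rlift 1 u r
      - k.-1%:R * r ^+ k.-2 * rlift 0 u r).

Lemma is_derive_radial_moment (R : realType) (k : nat) (u : R -> R) (r : R) :
  smooth_radial +oo%E u -> (k <= 2)%N ->
  is_derive r 1 (radial_moment k u) (r ^+ k.+1 * rlift 4 u r).
Proof.
move=> su k2.
have d j : is_derive r 1 (rlift j u) (rlift j.+1 u r).
  by apply: is_derive_rlift su _; rewrite ltry.
have p j : is_derive r 1 (fun x : R => x ^+ j) (j%:R * r ^+ j.-1).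
  by apply: is_derive_eq (is_derive_exprn j (is_derive_id r 1)) _; rewrite mulr1.
rewrite /radial_moment.
have e := is_deriveD (is_deriveB (is_deriveM (p k.+1) (d 3%N))
   (is_deriveM (is_deriveZ k.+1%:R (p k)) (d 2%N)))
   (is_deriveZ (k.+1 * k)%:R (is_deriveB (is_deriveM (p k.-1) (d 1%N))
   (is_deriveM (is_deriveZ k.-1%:R (p k.-2)) (d 0%N)))).
apply: (is_derive_eq e); rewrite /GRing.scale /=.
move: (rlift 0 u r) (rlift 1 u r) (rlift 2 u r) (rlift 3 u r) (rlift 4 u r).
by case: k k2 {e} => [|[|[|//]]] _ A B C D E /=; rewrite /GRing.scale /=; ring.
Qed.

Lemma radial_moment0 (R : realType) (beta : R) (k : nat) (u : R -> R) :
  radial_solution 3 beta +oo u -> radial_moment k u 0 = 0.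
Proof.
move=> /rlift_initial[h0 h1 h2 _]; rewrite /radial_moment h0 h1 h2.
by rewrite exprS !(mulr0, subr0, mul0r, addr0).
Qed.

Lemma is_derive_radial_moment_pos (R : realType) (beta : R) (k : nat)
    (u : R -> R) (r : R) : radial_solution 3 beta +oo u -> (k <= 2)%N -> 0 < r ->
  is_derive r 1 (radial_moment k u) (r ^+ 2 * (r ^+ k * expR (u r))).
Proof.
move=> sol k2 r0; have [_ su _ _] := sol.
apply: is_derive_eq (is_derive_radial_moment r su k2) _.
rewrite (rlift_equation sol) ?ltry//.
by rewrite exprSr expr2; move: (expR _) (r ^+ k) => A B; ring.
Qed.

Lemma continuous_radial_moment (R : realType) (k : nat) (u : R -> R) (r : R) :
  smooth_radial +oo%E u -> (k <= 2)%N -> {for r, continuous (radial_moment k u)}.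
Proof. by move=> su k2; exact: is_derive_continuous (is_derive_radial_moment r su k2). Qed.

(** With [v = r u], the moment [m = r v''' - v''] increases from 0, so that
    [v''' <= 0] forces [v'' <= - m <= - m 1 < 0] for [r >= 1]; integrating twice,
    [v] decays quadratically. *)
Lemma linear_decay (R : realType) (beta : R) (u : R -> R) :
  radial_solution 3 beta +oo u -> (forall r, 0 <= r -> rlift 3 u r <= 0) ->
  exists2 c, 0 < c & forall r, 0 <= r -> u r <= 2 * c - c * r.
Proof.
move=> sol X4le; have [_ su _ [u00 _ _ _]] := sol.
have [X10 X20 X30 _] := rlift_initial sol.
have d j (r : R) : is_derive r 1 (rlift j u) (rlift j.+1 u r).
  by apply: is_derive_rlift su _; rewrite ltry.
have cd j (r : R) : {for r, continuous (rlift j u)}.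
  exact: is_derive_continuous (d j r).
pose m := radial_moment 0 u.
have dm (r : R) : 0 < r -> is_derive r 1 m (r ^+ 2 * expR (u r)).
  move=> r0; have := is_derive_radial_moment_pos sol (leq0n 2) r0.
  by rewrite expr0 mul1r.
have cm (r : R) : {for r, continuous m} by exact: continuous_radial_moment.
have mE r : m r = r * rlift 3 u r - rlift 2 u r.
  by rewrite /m /radial_moment !expr0 expr1 muln0 mul0r addr0 !mul1r.
have m0 : m 0 = 0 by exact: radial_moment0 sol.
have m1 : 0 < m 1.
  rewrite -[ltLHS]m0; apply: (@derive_gt0_lt _ m (fun x => x ^+ 2 * expR (u x)) _ _ ltr01 (fun x _ => cm x)).
    by move=> x /andP[x0 _]; exact: dm.
  by move=> x /andP[x0 _]; rewrite mulr_gt0 ?expR_gt0// exprn_gt0.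
have mincr x y : 0 <= x -> x <= y -> m x <= m y.
  move=> x0 xy; apply: (@derive_ge0_le _ m (fun x => x ^+ 2 * expR (u x)) _ _ xy (fun x _ => cm x)).
    by move=> z /andP[xz _]; apply: dm; exact: le_lt_trans xz.
  by move=> z _; rewrite mulr_ge0 ?expR_ge0// sqr_ge0.
have X3le r : 0 <= r -> rlift 2 u r <= - m r.
  move=> r0; rewrite mE opprB lerBrDl gerDr; exact: mulr_ge0_le0 r0 (X4le _ r0).
have X3le0 r : 0 <= r -> rlift 2 u r <= 0.
  by move=> r0; rewrite (le_trans (X3le _ r0))// oppr_le0 -m0 mincr.
have X2le0 r : 0 <= r -> rlift 1 u r <= 0.
  move=> r0; rewrite -X20; apply: (@derive_le0_ge _ (rlift 1 u) (rlift 2 u) _ _ r0 (fun x _ => cd 1%N x)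
    (fun x _ => d 1%N x)) => x /andP[x0 _]; apply: X3le0; exact: ltW.
have X1le0 r : 0 <= r -> rlift 0 u r <= 0.
  move=> r0; rewrite -X10; apply: (@derive_le0_ge _ (rlift 0 u) (rlift 1 u) _ _ r0 (fun x _ => cd 0%N x)
    (fun x _ => d 0%N x)) => x /andP[x0 _]; apply: X2le0; exact: ltW.
have X2le r : 1 <= r -> rlift 1 u r <= - m 1 * (r - 1).
  move=> r1.
  have dg (x : R) : is_derive x 1 (fun x => rlift 1 u x + m 1 * (x - 1))
      (rlift 2 u x + m 1).
    have dx := is_derive_sub_cst x 1.
    apply: is_derive_eq (is_deriveD (d 1%N x) (is_deriveZ (m 1) dx)) _.
    by rewrite /GRing.scale /= mulr1.
  have := derive_le0_ge r1 (fun x _ => is_derive_continuous (dg x))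
    (fun x _ => dg x).
  rewrite subrr mulr0 addr0 => h; rewrite mulNr -subr_le0 opprK.
  apply: (le_trans (h _)); last exact: X2le0.
  move=> x /andP[x1 _]; have x0 : 0 <= x by rewrite ltW// (lt_trans ltr01).
  rewrite -lerBrDr sub0r (le_trans (X3le _ x0))// lerN2.
  by apply: mincr => //; exact: ltW.
have X1le r : 1 <= r -> rlift 0 u r <= - m 1 * ((r - 1) ^+ 2 / 2).
  move=> r1.
  have dg (x : R) : is_derive x 1 (fun x => rlift 0 u x + m 1 * ((x - 1) ^+ 2 / 2))
      (rlift 1 u x + m 1 * (x - 1)).
    have dx := is_derive_sub_cst x 1.
    have dx2 := is_deriveM (is_derive_exprn 2 dx) (is_derive_cst (2^-1 : R) x 1).
    apply: is_derive_eq (is_deriveD (d 0%N x) (is_deriveZ (m 1) dx2)) _.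
    by rewrite /GRing.scale /=; move: (m 1) (rlift 1 u x) => A B; field.
  have := derive_le0_ge r1 (fun x _ => is_derive_continuous (dg x))
    (fun x _ => dg x).
  rewrite subrr expr0n mul0r mulr0 addr0 => h; rewrite mulNr -subr_le0 opprK.
  apply: (le_trans (h _)); last exact: X1le0.
  move=> x /andP[x1 _]; rewrite -lerBrDr sub0r -mulNr.
  exact/X2le/ltW.
exists (m 1 / 8); first by rewrite divr_gt0.
move=> r r0.
move: (m 1) m1 X1le {mincr X2le} => mu mu0 X1le.
have [r2|r2] := leP 2 r; last first.
  have ule0 : u r <= 0.
    have [->|rn0] := eqVneq r 0; first by rewrite u00.
    have rp : 0 < r by rewrite lt_neqAle eq_sym rn0.
    by have := X1le0 _ r0; rewrite rlift0 pmulr_rle0.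
  rewrite (le_trans ule0)// [2 * _]mulrC -mulrBr.
  by rewrite mulr_ge0 ?subr_ge0 ?ltW// divr_gt0.
have rp : 0 < r by rewrite (lt_le_trans _ r2).
have r1 : 1 <= r by rewrite (le_trans _ r2)// ler1n.
have : rlift 0 u r <= r * (- (mu / 8 * r)).
  have -> : r * (- (mu / 8 * r)) = - mu * ((r / 2) ^+ 2 / 2) by field.
  apply: le_trans (X1le _ r1) _; rewrite !mulNr lerN2 ler_pM2l//.
  have h : r / 2 <= r - 1 by rewrite ler_pdivrMr//; clear -r2; lra.
  by rewrite ler_pM2r ?invr_gt0// ler_sqr ?nnegrE ?subr_ge0 ?divr_ge0.
rewrite rlift0 ler_pM2l// => /le_trans; apply.
by rewrite lerDr mulr_ge0// divr_ge0// ltW.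
Qed.

(** The limit is the supremum of [f]; the tail bound holds because
    [f + K / c * exp (- c r)] is nonincreasing. *)
Lemma expR_tail_limit (R : realType) (f df : R -> R) (K c : R) : 0 < c ->
  (forall x, {for x, continuous f}) ->
  (forall x : R, 0 < x -> is_derive x 1 f (df x)) ->
  (forall x, 0 < x -> 0 <= df x <= K * expR (- c * x)) ->
  exists2 l, (forall r, 0 <= r -> 0 <= l - f r <= K / c * expR (- c * r)) &
    forall b, (forall r, 0 <= r -> f r <= b) -> l <= b.
Proof.
move=> c0 cf dfE dfb.
have fincr x y : 0 <= x -> x <= y -> f x <= f y.
  move=> x0 xy; apply: (@derive_ge0_le _ f df _ _ xy (fun x _ => cf x)).
    by move=> z /andP[xz _]; apply: dfE; exact: le_lt_trans xz.
  move=> z /andP[xz _]; have z0 : 0 < z by exact: le_lt_trans xz.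
  by have /andP[] := dfb _ z0.
have K0 : 0 <= K.
  have /andP[h1 h2] := dfb 1 ltr01; have := le_trans h1 h2.
  by rewrite pmulr_lge0// expR_gt0.
pose E r := K / c * expR (- c * r).
have dE (r : R) : is_derive r 1 E (- (K * expR (- c * r))).
  have e1 := is_deriveZ (- c) (is_derive_id r 1).
  have e2 : is_derive r 1 (fun r => expR (- c * r)) (expR (- c * r) * (- c * 1)).
    exact: is_derive1_comp e1.
  apply: is_derive_eq (is_deriveZ (K / c) e2) _.
  by rewrite /GRing.scale /=; move: (expR _) => A; field; rewrite gt_eqF.
have E0 r : 0 <= E r by rewrite mulr_ge0 ?expR_ge0// divr_ge0// ltW.
have upper x y : 0 <= x -> x <= y -> f y <= f x + E x.
  move=> x0 xy.
  have dg (z : R) : 0 < z -> is_derive z 1 (fun z => f z + E z)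
      (df z - K * expR (- c * z)).
    by move=> z0; exact: is_deriveD (dfE _ z0) (dE z).
  apply: (@le_trans _ _ (f y + E y)); first by rewrite lerDl.
  apply: (@derive_le0_ge _ (fun z => f z + E z) _ _ _ xy) => z.
  - by move=> _; apply: continuousD (cf z) (is_derive_continuous (dE z)).
  - by move=> /andP[xz _]; apply: dg; exact: le_lt_trans xz.
  - move=> /andP[xz _]; rewrite subr_le0.
    by have /andP[] := dfb _ (le_lt_trans x0 xz).
pose S := [set f r | r in [set r | 0 <= r]].
have S0 : S !=set0 by exists (f 0); exists 0 => //=.
have ubS x : 0 <= x -> ubound S (f x + E x).
  move=> x0 _ [y /= y0 <-].
  have [xy|yx] := leP x y; first exact: upper.
  by rewrite (le_trans (fincr _ _ y0 (ltW yx)))// lerDl.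
have hS : has_sup S by split => //; exists (f 0 + E 0); exact: ubS.
exists (sup S) => [r r0|b fb]; last by apply: ge_sup => // _ [r /= r0 <-]; exact: fb.
rewrite subr_ge0 lerBlDl; apply/andP; split.
  by apply: sup_upper_bound => //; exists r.
exact: ge_sup (ubS _ r0).
Qed.

(** * Expansion of the separatrix *)

Lemma expR_tail_cvg (R : realType) (f : R -> R) (l T c : R) : 0 < c ->
  (forall r, 0 <= r -> 0 <= l - f r <= T * expR (- c * r)) ->
  f r @[r --> +oo] --> l.
Proof.
move=> c0 tail.
have e0 : (T * expR (- c * r)) @[r --> +oo] --> (0 : R).
  rewrite -[X in _ --> X](mulr0 T); apply: cvgMr.
  have cr : (c * r) @[r --> +oo] --> +oo.
    exact: gt0_cvgMry.
  rewrite (_ : (fun r => expR (- c * r)) = (fun x => expR (- x)) \o (fun r => c * r)).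
    exact: (cvg_comp _ _ cr (@cvgr_expR R)).
  by apply/funext => r /=; rewrite mulNr.
have lf : (l - f r) @[r --> +oo] --> (0 : R).
  apply: (squeeze_cvgr _ (cvg_cst 0) e0).
  by near=> r; apply: tail; near: r; exact: nbhs_pinfty_ge.
rewrite (_ : f = (fun r => l - (l - f r))); last by apply/funext => r; rewrite opprB addrC subrK.
by rewrite -[X in _ --> X]subr0; apply: cvgB => //; exact: cvg_cst.
Unshelve. all: end_near.
Qed.

(** Eliminating [(r u)'], [(r u)''] and [(r u)'''] between the moments gives
    [6 r u = r ^ 3 (r u)''' - 3 r ^ 2 m0 + 3 r m1 - m2], and each term converges
    exponentially fast, the first one to 0. *)
Lemma separatrix_expansion (R : realType) (beta : R) (u : R -> R) :
  radial_solution 3 beta +oo u ->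
  (forall r, 0 <= r -> rlift 3 u r <= 0) ->
  (forall eta, 0 < eta -> exists2 r, 0 <= r & - eta < rlift 3 u r) ->
  exists l : nat -> R,
    (forall k, (k <= 2)%N -> radial_moment k u r @[r --> +oo] --> l k) /\
    exists2 c, 0 < c & exists M, forall r, 1 <= r ->
      `|u r - (- (l 0 / 2) * r + l 1 / 2 + - (l 2 / 6) * r^-1)|
        <= M * expR (- c * r).
Proof.
move=> sol X4le X4sup; have [_ su _ _] := sol.
have [c2 c20 ule] := linear_decay sol X4le.
pose c := c2 / 2; have c0 : 0 < c by rewrite divr_gt0.
have bound j : exists2 K, 0 < K & forall r, 0 < r ->
    0 <= r ^+ j * expR (u r) <= K * expR (- c * r).
  have [K K0 hK] := exprn_le_expR j c0.
  exists (K * expR (2 * c2)); first by rewrite mulr_gt0 ?expR_gt0.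
  move=> r r0; rewrite mulr_ge0 ?expR_ge0 ?exprn_ge0 ?(ltW r0)//=.
  have -> : K * expR (2 * c2) * expR (- c * r) =
      (K * expR (c * r)) * expR (2 * c2 - c2 * r).
    rewrite -!mulrA -!expRD; congr (_ * expR _).
    by rewrite /c; field.
  by rewrite ler_pM ?exprn_ge0 ?expR_ge0 ?(ltW r0) ?hK ?(ltW r0) ?ler_expR ?ule ?(ltW r0).
have mtail k : (k <= 2)%N -> exists l T, 0 <= T /\
    forall r, 0 <= r -> 0 <= l - radial_moment k u r <= T * expR (- c * r).
  move=> k2; have [K K0 hK] := bound k.+2.
  have [|l hl _] := @expR_tail_limit _ (radial_moment k u)
      (fun r => r ^+ 2 * (r ^+ k * expR (u r))) K c c0
      (fun r => @continuous_radial_moment R k u r su k2)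
      (fun r r0 => is_derive_radial_moment_pos sol k2 r0).
    by move=> r r0; rewrite mulrA -exprD add2n hK.
  by exists l, (K / c); split => //; rewrite divr_ge0 ?ltW.
have [T T0 X4tail] : exists2 T, 0 <= T &
    forall r, 0 <= r -> `|rlift 3 u r| <= T * expR (- c * r).
  have [K K0 hK] := bound 1%N.
  have d (r : R) : is_derive r 1 (rlift 3 u) (rlift 4 u r).
    by apply: is_derive_rlift su _; rewrite ltry.
  have dpos (r : R) : 0 < r -> is_derive r 1 (rlift 3 u) (r * expR (u r)).
    by move=> r0; rewrite -(rlift_equation sol) ?ltry//.
  have [|l hl lub] := @expR_tail_limit _ (rlift 3 u) (fun r => r * expR (u r))
      K c c0 (fun r => is_derive_continuous (d r)) dpos.
    by move=> r r0; rewrite -[X in X * expR (u r)]expr1 hK.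
  have l0 : l = 0.
    apply/eqP; rewrite eq_le lub//=.
    rewrite leNgt; apply/negP => l0.
    have [|r r0 h] := X4sup (- l); first by rewrite oppr_gt0.
    have /andP[+ _] := hl _ r0; rewrite subr_ge0 leNgt => /negP; apply.
    by rewrite opprK in h.
  exists (K / c); first by rewrite divr_ge0 ?ltW.
  by move=> r r0; have /andP[_] := hl _ r0; rewrite l0 sub0r ler0_norm ?X4le.
have [l0 [T0' [T0'0 h0]]] := mtail 0 isT.
have [l1 [T1 [T10 h1]]] := mtail 1%N isT.
have [l2 [T2 [T20 h2]]] := mtail 2%N isT.
exists (fun k => if k is 0 then l0 else if k is 1 then l1 else l2); split.
  case=> [|[|[|//]]] _.
  - exact: expR_tail_cvg c0 h0.
  - exact: expR_tail_cvg c0 h1.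
  - exact: expR_tail_cvg c0 h2.
have c'0 : 0 < c / 2 by rewrite divr_gt0.
have [K K0 hK] := exprn_le_expR 3 c'0.
pose S := T + 3 * T0' + 3 * T1 + T2.
exists (c / 2) => //; exists (S * K) => r r1.
have r0 : 0 < r by rewrite (lt_le_trans ltr01).
have {}X4tail := X4tail _ (ltW r0).
have {h0}/andP[a0 b0] := h0 _ (ltW r0).
have {h1}/andP[a1 b1] := h1 _ (ltW r0).
have {h2}/andP[a2 b2] := h2 _ (ltW r0).
set e := expR (- c * r) in X4tail b0 b1 b2.
have eE : e = expR (- (c / 2) * r) * expR (- (c / 2) * r).
  by rewrite -expRD; congr expR; field.
pose N := r ^+ 3 * rlift 3 u r + 3 * (r ^+ 2 * (l0 - radial_moment 0 u r))
  - 3 * (r * (l1 - radial_moment 1 u r)) + (l2 - radial_moment 2 u r).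
have -> : u r - (- (l0 / 2) * r + l1 / 2 + - (l2 / 6) * r^-1) = N / (6 * r).
  rewrite /N /radial_moment rlift0.
  move: (rlift 3 u r) (rlift 2 u r) (rlift 1 u r) (u r) => A B C D /=.
  by field; rewrite gt_eqF.
have Nle : `|N| <= r ^+ 3 * (S * e).
  have r2 : r ^+ 2 <= r ^+ 3 by rewrite ler_weXn2l.
  have r3 : r <= r ^+ 3 by rewrite -[leLHS]expr1 ler_weXn2l.
  have r4 : 1 <= r ^+ 3 by rewrite exprn_ege1.
  have r30 : 0 <= r ^+ 3 by rewrite exprn_ge0// ltW.
  have -> : r ^+ 3 * (S * e) = r ^+ 3 * (T * e) + 3 * (r ^+ 3 * (T0' * e))
    + 3 * (r ^+ 3 * (T1 * e)) + r ^+ 3 * (T2 * e) by rewrite /S; ring.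
  rewrite /N (le_trans (ler_normD _ _))// lerD//; last first.
    by rewrite ger0_norm// (le_trans b2)// ler_peMl// (le_trans a2 b2).
  rewrite (le_trans (ler_normB _ _))// lerD//; last first.
    by rewrite !normrM ger0_norm// ler_pM2l// ler_pM// ger0_norm// ltW.
  rewrite (le_trans (ler_normD _ _))// lerD//; last first.
    rewrite normrM (normrM (r ^+ 2)) ger0_norm// ler_pM2l// ler_pM//.
      by rewrite ger0_norm// sqr_ge0.
    by rewrite ger0_norm.
  by rewrite normrM (ger0_norm r30) ler_wpM2l.
have S0 : 0 <= S by rewrite !addr_ge0 ?mulr_ge0.
rewrite normrM [X in _ * X]ger0_norm ?invr_ge0 ?mulr_ge0 ?(ltW r0)//.
rewrite ler_pdivrMr ?mulr_gt0//.
apply: (@le_trans _ _ (S * K * expR (- (c / 2) * r))); last first.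
  rewrite ler_peMr ?mulr_ge0 ?expR_ge0 ?(ltW K0)//; lra.
have : r ^+ 3 * expR (- (c / 2) * r) <= K.
  rewrite (le_trans (ler_wpM2r (expR_ge0 _) (hK _ (ltW r0))))//.
  by rewrite mulNr expRN mulfK ?gt_eqF ?expR_gt0.
move=> PK0; apply: (le_trans Nle); rewrite eE.
move: PK0; move: (expR _) (expR_ge0 (- (c / 2) * r)) (r ^+ 3) => E E0 P PK.
have -> : P * (S * (E * E)) = S * ((P * E) * E) by ring.
by rewrite -(mulrA S K) ler_wpM2l// ler_wpM2r.
Qed.

(** * Volume of the Euclidean ball *)

(** Substitution [x = s sin t], which avoids the endpoint singularities of the
    primitive of the integrand. *)
Lemma integral_half_disc (R : realType) (s : R) : 0 < s ->
  (\int[@lebesgue_measure R]_(x in `[(- s)%R, s]) (Num.sqrt (s ^+ 2 - x ^+ 2))%:E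
    = (pi * s ^+ 2 / 2)%:E)%E.
Proof.
move=> s0.
pose F (t : R) := s * sin t.
have dF (t : R) : is_derive t 1 F (s * cos t).
  by rewrite /F; apply: is_derive_eq (is_deriveZ s (is_derive_sin t)) _.
have F'E : derive1 F = fun t => s * cos t.
  by apply/funext => t; rewrite derive1E (@derive_val _ _ _ _ _ _ _ (dF t)).
have cF : continuous F by move=> t; exact: is_derive_continuous (dF t).
have cF' : continuous (derive1 F).
  rewrite F'E => t; apply: is_derive_continuous (is_deriveZ s (is_derive_cos t)).
have pp : - (pi / 2) < pi / 2 :> R by rewrite gtrN// divr_gt0// pi_gt0.
have Fpi : F (pi / 2) = s by rewrite /F sin_pihalf mulr1.
have FNpi : F (- (pi / 2)) = - s by rewrite /F sinN sin_pihalf mulrN1.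
have cG (x : R) : {for x, continuous (fun x : R => Num.sqrt (s ^+ 2 - x ^+ 2))}.
  apply: (@continuous_comp _ _ _ (fun x : R => s ^+ 2 - x ^+ 2) Num.sqrt).
    by apply: continuousB; [exact: cst_continuous|exact: exprn_continuous].
  exact: sqrt_continuous.
transitivity (\int[@lebesgue_measure R]_(x in `[(- (pi / 2))%R, (pi / 2)%R])
    (s ^+ 2 * cos x ^+ 2)%:E)%E.
  rewrite -[in LHS]FNpi -[X in `[_, X]]Fpi.
  rewrite integration_by_substitution_increasing//.
  - apply: eq_integral => t; rewrite inE /= in_itv /= => tI.
    rewrite F'E; suff : Num.sqrt (s ^+ 2 - (s * sin t) ^+ 2) * (s * cos t)
      = s ^+ 2 * cos t ^+ 2 by move=> <-.
    rewrite exprMn -{1}[s ^+ 2]mulr1 -mulrBr -cos2sin2.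
    rewrite sqrtrM ?sqr_ge0// !sqrtr_sqr ger0_norm ?(ltW s0)//.
    by rewrite ger0_norm ?cos_ge0_pihalf//; ring.
  - exact: ltW.
  - move=> x y; rewrite !in_itv /= => /andP[x1 x2] /andP[y1 y2] xy.
    apply: (@derive_gt0_lt _ F (fun t => s * cos t) _ _ xy (fun z _ => cF z)
      (fun z _ => dF z)) => z /andP[xz zy].
    by rewrite mulr_gt0// cos_gt0_pihalf// (le_lt_trans x1)//= (lt_le_trans zy).
  - apply/cvg_ex; exists (derive1 F (- (pi / 2))); apply: cvg_at_right_filter; exact: (cF' _).
  - apply/cvg_ex; exists (derive1 F (pi / 2)); apply: cvg_at_left_filter; exact: (cF' _).
  - split; first by move=> x _; have [] := dF x.
    + by apply: cvg_at_right_filter; exact: cF.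
    + by apply: cvg_at_left_filter; exact: cF.
  - by apply: continuous_subspaceT => x; exact: cG.
pose H (t : R) := s ^+ 2 * ((t + sin t * cos t) / 2).
have dH (t : R) : is_derive t 1 H (s ^+ 2 * cos t ^+ 2).
  have e := is_deriveM (is_deriveD (is_derive_id t 1)
    (is_deriveM (is_derive_sin t) (is_derive_cos t))) (is_derive_cst (2^-1 : R) t 1).
  apply: is_derive_eq (is_deriveZ (s ^+ 2) e) _.
  rewrite /GRing.scale /=.
  have -> : (sin t * - sin t + cos t * cos t) = 2 * cos t ^+ 2 - 1.
    by rewrite mulrN -expr2 sin2cos2; move: (cos t) => c; ring.
  by move: (cos t) => c; field.
rewrite (@continuous_FTC2 _ _ H)//.
- rewrite /H sinN cosN cos_pihalf !mulr0 !addr0 -EFinB; congr EFin.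
  by field.
- apply: continuous_subspaceT => t.
  exact: (is_derive_continuous
    (is_deriveZ (s ^+ 2) (is_derive_exprn 2 (is_derive_cos t)))).
- split; first by move=> x _; have [] := dH x.
  + by apply: cvg_at_right_filter; apply: is_derive_continuous (dH _).
  + by apply: cvg_at_left_filter; apply: is_derive_continuous (dH _).
- by move=> x _; rewrite derive1E (@derive_val _ _ _ _ _ _ _ (dH x)).
Qed.

Local Open Scope ereal_scope.

Lemma measurable_enorm3 (R : realType) :
  measurable_fun [set: R * R * R] (@enorm3 R).
Proof.
apply: (@measurableT_comp _ _ _ _ _ _ (@Num.sqrt R)).
  by apply: continuous_measurable_fun; exact: sqrt_continuous.
apply: measurable_funD; first apply: measurable_funD.
- apply: measurable_funX.
  exact: (measurableT_comp measurable_fst measurable_fst).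
- apply: measurable_funX.
  exact: (measurableT_comp measurable_snd measurable_fst).
- by apply: measurable_funX; exact: measurable_snd.
Qed.

Lemma lebesgue_measure_sqr_le (R : realType) (q : R) :
  @lebesgue_measure R [set y | (y ^+ 2 <= q)%R] = (2 * Num.sqrt q)%:E.
Proof.
have [q0|q0] := leP 0%R q; last first.
  rewrite ler0_sqrtr ?(ltW q0)// mulr0 (_ : [set y | _] = set0) ?measure0//.
  apply/seteqP; split => // y /= /(le_lt_trans)/(_ q0).
  by rewrite ltNge sqr_ge0.
rewrite (_ : [set y | _] = [set` `[- Num.sqrt q, Num.sqrt q]%R]); last first.
  apply/seteqP; split => y /=; rewrite in_itv /= -ler_norml -sqrtr_sqr.
    by move=> yq; rewrite ler_wsqrtr.
  by rewrite ler_sqrt.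
rewrite lebesgue_measure_itv /= lte_fin; case: ifPn => [_|].
  by rewrite -EFinB; congr EFin; ring.
rewrite -leNgt lerNr => h.
have -> : Num.sqrt q = 0%R.
  by apply/eqP; rewrite eq_le sqrtr_ge0 andbT; have := sqrtr_ge0 q; lra.
by rewrite mulr0.
Qed.

(** The area of a disc of squared radius [q] as the sum of its chords; truncating
    [q] at 0 matches the convention that the square root of a negative number
    is 0. *)
Lemma integral_chord (R : realType) (q : R) :
  \int[@lebesgue_measure R]_x (2 * Num.sqrt (q - x ^+ 2))%:E
    = (pi * Num.max q 0)%:E.
Proof.
have [q0|q0] := leP q 0%R.
  rewrite mulr0 integral0_eq// => x _; rewrite ler0_sqrtr ?mulr0//.
  by rewrite subr_le0 (le_trans q0)// sqr_ge0.
pose s := Num.sqrt q.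
have s0 : (0 < s)%R by rewrite sqrtr_gt0.
have sq : (s ^+ 2 = q)%R by rewrite sqr_sqrtr// ltW.
transitivity (\int[@lebesgue_measure R]_(x in `[(- s)%R, s])
    (2 * Num.sqrt (s ^+ 2 - x ^+ 2))%:E).
  rewrite [RHS]integral_mkcond; apply: eq_integral => x _; rewrite patchE sq.
  case: ifPn => // /negP; rewrite inE /= in_itv /= -ler_norml => /negP.
  rewrite -ltNge => sx; rewrite ler0_sqrtr ?mulr0// subr_le0 -sq.
  by rewrite -[(x ^+ 2)%R]real_normK ?num_real// ler_sqr ?nnegrE// ltW.
under eq_integral do rewrite EFinM.
rewrite ge0_integralZl_EFin//=.
- by rewrite integral_half_disc// -EFinM sq; congr EFin; field.
- apply/measurable_EFinP; apply: measurable_funTS.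
  apply: continuous_measurable_fun => x.
  apply: (@continuous_comp _ _ _ (fun x : R => s ^+ 2 - x ^+ 2)%R Num.sqrt).
    by apply: continuousB; [exact: cst_continuous|exact: exprn_continuous].
  exact: sqrt_continuous.
Qed.

Lemma integral_disc_areas (R : realType) (r : R) : (0 <= r)%R ->
  \int[@lebesgue_measure R]_z (pi * Num.max (r ^+ 2 - z ^+ 2) 0)%:E
    = (4 * pi / 3 * r ^+ 3)%:E.
Proof.
rewrite le_eqVlt => /predU1P[<-|r0].
  rewrite !expr0n mulr0 integral0_eq// => z _ /=.
  by rewrite max_r ?mulr0// sub0r oppr_le0 sqr_ge0.
transitivity (\int[@lebesgue_measure R]_(z in `[(- r)%R, r])
    (pi * (r ^+ 2 - z ^+ 2))%:E).
  rewrite [RHS]integral_mkcond; apply: eq_integral => x _; rewrite patchE.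
  rewrite -[(x ^+ 2)%R]real_normK ?num_real//.
  case: ifPn => [|/negP]; rewrite inE /= in_itv /= -ler_norml => h.
    by rewrite max_l// subr_ge0 ler_sqr ?nnegrE// ltW.
  rewrite max_r ?mulr0// subr_le0 ler_sqr ?nnegrE// ?ltW//.
  by rewrite ltNge; exact/negP.
pose H (z : R) : R := (pi * (r ^+ 2 * z - z ^+ 3 * 3^-1))%R.
have dH (z : R) : is_derive z 1%R H (pi * (r ^+ 2 - z ^+ 2))%R.
  have e := is_deriveB (is_deriveZ (r ^+ 2)%R (is_derive_id z 1%R))
    (is_deriveM (is_derive_exprn 3 (is_derive_id z 1%R))
      (is_derive_cst (3^-1 : R)%R z 1%R)).
  apply: is_derive_eq (is_deriveZ pi e) _.
  by rewrite /GRing.scale /=; move: pi => p; field.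
rewrite (@continuous_FTC2 _ _ H) ?gtrN//.
- by rewrite -EFinB /H; congr EFin; move: pi => p; field.
- apply: continuous_subspaceT => z.
  exact: (is_derive_continuous (is_deriveZ pi
    (is_deriveB (is_derive_cst (r ^+ 2)%R z 1%R)
      (is_derive_exprn 2 (is_derive_id z 1%R))))).
- split; first by move=> x _; have [] := dH x.
  + by apply: cvg_at_right_filter; apply: is_derive_continuous (dH _).
  + by apply: cvg_at_left_filter; apply: is_derive_continuous (dH _).
- by move=> x _; rewrite derive1E (@derive_val _ _ _ _ _ _ _ (dH x)).
Qed.

(** Integrate the chord lengths over the first two coordinates; for a fixed first
    coordinate [x] they add up to the area of a disc of squared radius
    [r ^ 2 - x ^ 2]. *)
Lemma lebesgue3_ball (R : realType) (r : R) : (0 <= r)%R ->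
  @lebesgue3 R [set x | (enorm3 x <= r)%R] = (4 * pi / 3 * r ^+ 3)%:E.
Proof.
move=> r0.
transitivity (\int[@lebesgue_measure R \x @lebesgue_measure R]_p
    (2 * Num.sqrt (r ^+ 2 - p.1 ^+ 2 - p.2 ^+ 2))%:E).
  apply: eq_integral => p _ /=; rewrite -lebesgue_measure_sqr_le.
  congr (_ _); apply/seteqP; split => z.
    rewrite /xsection /= inE /= /enorm3 /= => h; rewrite !lerBrDl.
    by rewrite addrA -ler_sqrt ?exprn_ge0// sqrtr_sqr ger0_norm.
  rewrite /xsection /= inE /= /enorm3 /= !lerBrDl addrA => h.
  by rewrite -[leRHS]ger0_norm// -sqrtr_sqr ler_wsqrtr.
rewrite fubini_tonelli1.
- transitivity (\int[@lebesgue_measure R]_z (pi * Num.max (r ^+ 2 - z ^+ 2) 0)%:E).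
    by apply: eq_integral => z _; rewrite -integral_chord.
  exact: integral_disc_areas.
- apply/measurable_EFinP/measurable_funM => //.
  apply: (@measurableT_comp _ _ _ _ _ _ (@Num.sqrt R)).
    by apply: continuous_measurable_fun; exact: sqrt_continuous.
  apply: measurable_funB; first apply: measurable_funB => //.
    by apply: measurable_funX; exact: measurable_fst.
  by apply: measurable_funX; exact: measurable_snd.
- by move=> p; rewrite lee_fin mulr_ge0 ?sqrtr_ge0.
Qed.

Local Close Scope ereal_scope.

(** * Integrals of radial functions *)

Lemma is_derive_zero (R : realType) (F : R -> R) (x : R) :
  (forall e, 0 < e -> \forall y \near x, `|F y - F x| <= e * `|y - x|) ->
  is_derive x 1 F 0.
Proof.
move=> small; apply/is_derive1_caratheodory.
exists (fun y => (F y - F x) / (y - x)); split.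
- move=> y; have [->|yx] := eqVneq y x; first by rewrite !subrr mulr0.
  by rewrite divfK// subr_eq0.
- apply/cvgrPdist_le => e e0; near=> y.
  rewrite /= !subrr invr0 mulr0 sub0r normrN normrM normfV.
  have [->|yx] := eqVneq y x; first by rewrite !subrr normr0 mul0r ltW.
  rewrite ler_pdivrMr ?normr_gt0 ?subr_eq0//.
  by near: y; exact: small.
- by rewrite subrr mul0r.
Unshelve. all: end_near.
Qed.

Lemma continuous_segment_close (R : realType) (h : R -> R) (x e : R) :
  {for x, continuous h} -> 0 < e ->
  \forall y \near x, forall z, Num.min x y <= z <= Num.max x y ->
    `|h z - h x| <= e.
Proof.
move=> ch e0.
have /nbhs_ballP[d /= d0 hd] : \forall z \near x, `|h x - h z| <= e.
  by move/cvgrPdist_le : ch => /(_ _ e0).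
near=> y => z /andP[z1 z2]; rewrite distrC; apply: hd; rewrite /ball /=.
have : `|x - y| < d.
  by near: y; apply/nbhs_ballP; exists d.
rewrite !ltr_norml => /andP[h1 h2]; move: z1 z2.
rewrite ge_min le_max => /orP[] z1 /orP[] z2; apply/andP; split; lra.
Unshelve. all: end_near.
Qed.

(** The argument only uses the measure of the balls of [rho], so it is carried out
    for an arbitrary measure space. The shells between two radii compare both the
    integral of [h (rho x)] and [3 C H] with multiples of [C (b ^ 3 - a ^ 3)]; hence
    their difference [F] has derivative 0 for [r > 0], and it vanishes at 0. *)
Section radial_integral.
Context d (T : measurableType d) (R : realType) (mu : {measure set T -> \bar R}).
Variables (rho : T -> R) (C : R).
Hypotheses (mrho : measurable_fun [set: T] rho) (rho0 : forall x, 0 <= rho x).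
Hypothesis muball : forall r, 0 <= r -> mu [set x | rho x <= r] = (C * r ^+ 3)%:E.
Variables (h H : R -> R).
Hypotheses (ch : continuous h) (h0 : forall r, 0 <= r -> 0 <= h r).
Hypotheses (cH : {for 0, continuous H}) (H0 : H 0 = 0).
Hypothesis dH : forall r : R, 0 < r -> is_derive r 1 H (r ^+ 2 * h r).

Let B r := [set x | rho x <= r].
Let I r := (\int[mu]_(x in B r) (h (rho x))%:E)%E.

Let muB r : 0 <= r -> mu (B r) = (C * r ^+ 3)%:E.
Proof. exact: muball. Qed.

Let mB r : measurable (B r).
Proof.
rewrite (_ : B r = [set: T] `&` rho @^-1` [set` `]-oo, r]]).
  exact: (mrho measurableT (measurable_itv _)).
by apply/seteqP; split => x; rewrite /B /= in_itv //= => -[].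
Qed.

Let mh D : measurable D -> measurable_fun D (fun x => (h (rho x))%:E).
Proof.
move=> mD; apply/measurable_EFinP; apply: measurable_funTS.
apply: measurableT_comp mrho.
exact: continuous_measurable_fun.
Qed.

Let hrho0 x : (0 <= (h (rho x))%:E)%E.
Proof. by rewrite lee_fin h0. Qed.

Let C0 : 0 <= C.
Proof.
have : (0 <= mu (B 1%R))%E by exact: measure_ge0.
rewrite muB// lee_fin.
by rewrite expr1n mulr1.
Qed.

Let shell a b : 0 <= a -> a <= b ->
  mu (B b `\` B a) = (C * (b ^+ 3 - a ^+ 3))%:E.
Proof.
move=> a0 ab; have b0 := le_trans a0 ab.
have fin : (mu (B b) < +oo)%E by rewrite muB// ltry.
transitivity (mu (B b) - mu (B b `&` B a))%E; first exact: measureD.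
have -> : B b `&` B a = B a.
  by apply/setIidPr => x /= /le_trans; exact.
by rewrite !muB// -EFinB mulrBr.
Qed.

Let I_split a b : a <= b ->
  I b = (I a + \int[mu]_(x in B b `\` B a) (h (rho x))%:E)%E.
Proof.
move=> ab.
have e : B b = B a `|` (B b `\` B a).
  by rewrite setDUK// => x /= /le_trans; exact.
rewrite /I [in LHS]e ge0_integral_setU//.
- exact: measurableD.
- by rewrite -e; exact: mh.
- by apply/disj_setPS => x [] ? [].
Qed.

Let int_cst D r : measurable D -> (\int[mu]_(x in D) r%:E = r%:E * mu D)%E.
Proof. by move=> mD; exact: integral_cst. Qed.

Let shell_bound a b m M : 0 <= a -> a <= b -> 0 <= m ->
  (forall r, a <= r <= b -> m <= h r <= M) ->
  ((m * (C * (b ^+ 3 - a ^+ 3)))%:E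
    <= \int[mu]_(x in B b `\` B a) (h (rho x))%:E
    <= (M * (C * (b ^+ 3 - a ^+ 3)))%:E)%E.
Proof.
move=> a0 ab m0 hmM.
have mS : measurable (B b `\` B a) by exact: measurableD.
have inS x : (B b `\` B a) x -> m <= h (rho x) <= M.
  by move=> [/= xb /negP]; rewrite -ltNge => ax; apply: hmM; rewrite xb ltW.
rewrite !(EFinM _ (C * _)) -shell// -!int_cst//; apply/andP; split.
- apply: ge0_le_integral => //.
  + exact: mh.
  + by move=> x /inS /andP[? _]; rewrite lee_fin.
- apply: ge0_le_integral => //.
  + exact: mh.
  + by move=> x /inS /andP[_ ?]; rewrite lee_fin.
Qed.

Let I0 : I 0 = 0%E.
Proof.
rewrite /I (_ : (\int[mu]_(x in B 0%R) _)%E = (\int[mu]_(x in B 0%R) (h 0)%:E)%E).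
  by rewrite int_cst// muB// expr0n mulr0 mule0.
apply: eq_integral => x; rewrite inE /B /= => x0; congr (h _)%:E.
by apply/le_anti; rewrite x0 rho0.
Qed.

Let bounded_on b : 0 <= b -> exists2 M, 0 <= M &
  forall r, 0 <= r <= b -> 0 <= h r <= M.
Proof.
move=> b0.
have ch' : {within `[0, b], continuous h} by apply: continuous_subspaceT.
have [c cb hc] := EVT_max b0 ch'.
have c0 : 0 <= c by move: cb; rewrite in_itv /= => /andP[].
exists (h c); first exact: h0.
by move=> r /andP[r0 rb]; rewrite h0//= hc// in_itv /= r0.
Qed.

Let I_fin b : 0 <= b -> I b \is a fin_num.
Proof.
move=> b0; have [M M0 hM] := bounded_on b0.
have /andP[h1 h2] := shell_bound (lexx 0) b0 (lexx 0) hM.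
rewrite (I_split b0) I0 add0e ge0_fin_numE; last exact: integral_ge0.
by rewrite (le_lt_trans h2)// ltry.
Qed.

Let F r := fine (I r) - 3 * C * H r.

Let cHge0 r : 0 <= r -> {for r, continuous H}.
Proof.
rewrite le_eqVlt => /predU1P[<-//|r0]; exact: is_derive_continuous (dH r0).
Qed.

(* Both bounds of [H_increment] are instances, with [(p, q) = (- m, 1)] and
   [(M, -1)]. *)
Let cubeH_le a b (p q : R) : 0 <= a -> a <= b ->
  (forall r, a < r < b -> 0 <= p * (C * (3 * r ^+ 2)) + q * (C * (3 * r ^+ 2)) * h r) ->
  0 <= p * (C * (b ^+ 3 - a ^+ 3)) + q * (3 * C * H b - 3 * C * H a).
Proof.
move=> a0 ab hpq.
pose G z := p * (C * z ^+ 3) + q * (3 * C * H z).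
have : G a <= G b.
  apply: (@derive_ge0_le _ G (fun r => p * (C * (3 * r ^+ 2))
      + q * (C * (3 * r ^+ 2)) * h r) _ _ ab) => [x /andP[ax _]|x /andP[ax _]|//].
  - apply: continuousD; apply: continuousM; try exact: cst_continuous.
      by apply: continuousM; [exact: cst_continuous|exact: exprn_continuous].
    apply: continuousM; first exact: cst_continuous.
    by apply: cHge0; exact: le_trans ax.
  - have dHx := dH (le_lt_trans a0 ax).
    have d3 := is_derive_exprn 3 (is_derive_id x 1).
    apply: is_derive_eq (is_deriveD (is_deriveZ p (is_deriveZ C d3))
      (is_deriveZ q (is_deriveZ (3 * C) dHx))) _.
    by rewrite /GRing.scale /=; move: (h x) => y; ring.
rewrite /G -subr_ge0; congr (0 <= _).
by move: (H a) (H b) => Ha Hb; ring.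
Qed.

Let H_increment a b m M : 0 <= a -> a <= b ->
  (forall r, a <= r <= b -> m <= h r <= M) ->
  m * (C * (b ^+ 3 - a ^+ 3)) <= 3 * C * H b - 3 * C * H a
    <= M * (C * (b ^+ 3 - a ^+ 3)).
Proof.
move=> a0 ab hmM.
have w r : 0 <= C * (3 * r ^+ 2) by rewrite mulr_ge0// mulr_ge0// sqr_ge0.
have inab r : a < r < b -> m <= h r <= M.
  by move=> /andP[ar rb]; apply: hmM; rewrite !ltW.
apply/andP; split.
- have := @cubeH_le a b (- m) 1 a0 ab.
  rewrite mulNr mul1r addrC subr_ge0; apply => r /inab /andP[h1 _].
  by rewrite mul1r mulNr mulrC addrC -mulrBr mulr_ge0// subr_ge0.
- have := @cubeH_le a b M (- 1) a0 ab.
  rewrite mulN1r subr_ge0; apply => r /inab /andP[_ h1].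
  by rewrite mulN1r mulNr mulrC -mulrBr mulr_ge0// subr_ge0.
Qed.

Let F_increment a b m M : 0 <= a -> a <= b -> 0 <= m ->
  (forall r, a <= r <= b -> m <= h r <= M) ->
  `|F b - F a| <= (M - m) * (C * (b ^+ 3 - a ^+ 3)).
Proof.
move=> a0 ab m0 hmM.
have b0 := le_trans a0 ab.
have /andP[] := shell_bound a0 ab m0 hmM.
have Ib := I_split ab.
have fS : (\int[mu]_(x in B b `\` B a) (h (rho x))%:E)%E \is a fin_num.
  have := I_fin b0; rewrite Ib fin_numD => /andP[] //.
rewrite -(fineK fS) !lee_fin.
have -> : fine (\int[mu]_(x in B b `\` B a) (h (rho x))%:E)%E
    = fine (I b) - fine (I a).
  rewrite Ib (fineD (I_fin a0) fS).
  by rewrite [RHS]addrC addKr.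
have := H_increment a0 ab hmM; rewrite /F.
move: (C * (b ^+ 3 - a ^+ 3)) (fine (I b)) (fine (I a)) => V ib ia.
move: (3 * C * H b) (3 * C * H a) => Hb Ha.
by move=> /andP[? ?] ? ?; rewrite ler_norml; apply/andP; split; lra.
Qed.

Let dF (r : R) : 0 < r -> is_derive r 1 F 0.
Proof.
move=> r0; apply: is_derive_zero => e e0.
(* [K] is a Lipschitz constant of [C x ^ 3] on [[0, r + 1]]. *)
pose K := C * (3 * (r + 1) ^+ 2) + 1.
have K0 : 0 < K by rewrite ltr_wpDl// mulr_ge0// mulr_ge0// sqr_ge0.
pose e' := e / K / 2.
have e'0 : 0 < e' by rewrite !divr_gt0.
have small a b : 0 <= a -> a <= b -> b <= r + 1 ->
    (forall z, a <= z <= b -> `|h z - h r| <= e') -> `|F b - F a| <= e * (b - a).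
  move=> a0 ab br hz.
  have b0 := le_trans a0 ab.
  (* The truncation at 0 keeps the lower bound nonnegative, as needed to compare
     integrals. *)
  pose m := Num.max 0 (h r - e').
  have hm z : a <= z <= b -> m <= h z <= h r + e'.
    move=> /[dup] zab /hz; rewrite ler_norml => /andP[h1 h2].
    have z0 : 0 <= z by case/andP: zab => az _; exact: le_trans az.
    rewrite ge_max h0//=; apply/andP; split; lra.
  have m0 : 0 <= m by rewrite le_max lexx.
  have mge : h r - e' <= m by rewrite le_max lexx orbT.
  apply: (le_trans (F_increment a0 ab m0 hm)).
  have Mm : h r + e' - m <= e / K.
    by rewrite [leRHS]splitr -/e'; lra.
  have cube : C * (b ^+ 3 - a ^+ 3) <= K * (b - a).
    have -> : b ^+ 3 - a ^+ 3 = (b ^+ 2 + b * a + a ^+ 2) * (b - a) by ring.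
    rewrite mulrA ler_wpM2r ?subr_ge0// /K ler_wpDr// ler_wpM2l//.
    have ar := le_trans ab br.
    have h1 : b ^+ 2 <= (r + 1) ^+ 2 by rewrite ler_sqr ?nnegrE// addr_ge0// ltW.
    have h2 : a ^+ 2 <= (r + 1) ^+ 2 by rewrite ler_sqr ?nnegrE// addr_ge0// ltW.
    have h3 : b * a <= (r + 1) ^+ 2 by rewrite expr2 ler_pM.
    move: ((r + 1) ^+ 2) h1 h2 h3 => X; lra.
  have pos : 0 <= C * (b ^+ 3 - a ^+ 3).
    by rewrite mulr_ge0// subr_ge0 lerXn2r.
  rewrite (le_trans (ler_wpM2r pos Mm))//.
  have eK : 0 <= e / K by rewrite divr_ge0 ?ltW.
  apply: (le_trans (ler_wpM2l eK cube)).
  by rewrite mulrA divfK// gt_eqF.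
near=> y.
have y0 : 0 < y by near: y; exact: lt_nbhsr.
have yr : y < r + 1 by near: y; apply: lt_nbhsl; rewrite ltrDl.
have hz : forall z, Num.min r y <= z <= Num.max r y -> `|h z - h r| <= e'.
  by near: y; apply: continuous_segment_close => //; exact: ch.
have [ry|yr'] := leP r y.
  rewrite (ger0_norm (_ : 0 <= y - r)) ?subr_ge0//.
  apply: small => //; [exact: ltW|exact: ltW|].
  by move=> z zi; apply: hz; rewrite (min_l ry) (max_r ry).
have ry : 0 <= r - y by rewrite subr_ge0 ltW.
rewrite distrC (distrC y) (ger0_norm ry).
apply: small; [exact: ltW|exact: ltW|by rewrite lerDl|].
by move=> z zi; apply: hz; rewrite (min_r (ltW yr')) (max_l (ltW yr')).
Unshelve. all: end_near.
Qed.

Let F0 : F 0 = 0.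
Proof. by rewrite /F I0 H0 mulr0 subr0. Qed.

Let F_eq0 b : 0 < b -> F b = 0.
Proof.
move=> b0; have [M M0 hM] := bounded_on (ltW b0).
have Fcst a : 0 < a -> a <= b -> F b = F a.
  move=> a0 ab.
  have dFx (x : R) : a <= x -> is_derive x 1 F 0 by move=> ax; apply: dF; exact: lt_le_trans ax.
  have cF (x : R) (xab : a <= x <= b) : {for x, continuous F}.
    by case/andP: xab => ax _; exact: is_derive_continuous (dFx _ ax).
  have dFab (x : R) (xab : a < x < b) : is_derive x 1 F ((fun=> 0) x).
    by case/andP: xab => ax _; exact: dFx (ltW ax).
  apply/le_anti; apply/andP; split.
    exact: (derive_le0_ge ab cF dFab).
  exact: (derive_ge0_le ab cF dFab).
have Fle a : 0 < a -> a <= b -> `|F b| <= M * (C * a ^+ 3).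
  move=> a0 ab; rewrite (Fcst a)//.
  have := @F_increment 0 a 0 M (lexx 0) (ltW a0) (lexx 0).
  rewrite F0 !subr0 expr0n subr0; apply => r /andP[r0 ra].
  by apply: hM; rewrite r0 (le_trans ra).
apply/eqP; rewrite -normr_le0; apply/ler_addgt0Pl => e e0; rewrite addr0.
pose a := Num.min (Num.min b 1) (e / (M * C + 1)).
have MC : 0 < M * C + 1 by rewrite ltr_wpDl// mulr_ge0.
have a0 : 0 < a by rewrite !lt_min b0 ltr01 divr_gt0.
have ab : a <= b by rewrite !ge_min lexx.
have a1 : a <= 1 by rewrite !ge_min lexx orbT.
have ae : a <= e / (M * C + 1) by rewrite ge_min lexx orbT.
apply: (le_trans (Fle a a0 ab)).
have a3 : a ^+ 3 <= a by rewrite -[leRHS]expr1 ler_wiXn2l// ltW.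
rewrite mulrA (le_trans (ler_wpM2l _ a3)) ?mulr_ge0//.
move: ae; rewrite ler_pdivlMr// => /(le_trans _); apply.
by rewrite mulrC ler_pM2l// lerDl.
Qed.

(** Monotone convergence along the balls of integer radius. *)
Lemma integral_radial l : H r @[r --> +oo] --> l ->
  (\int[mu]_x (h (rho x))%:E)%E = (3 * C * l)%:E.
Proof.
move=> Hl.
have IE (n : nat) : I n%:R = (3 * C * H n%:R)%:E.
  have [->|n0] := eqVneq n 0%N; first by rewrite I0 H0 mulr0.
  have np : 0 < n%:R :> R by rewrite ltr0n lt0n.
  rewrite -[LHS]fineK ?I_fin ?ltW//; congr EFin.
  by apply/eqP; rewrite -subr_eq0; apply/eqP; exact: F_eq0.
have BT : \bigcup_n B n%:R = [set: T].
  apply/seteqP; split => // x _; exists (Num.truncn (rho x)).+1 => //=.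
  by rewrite /B /= ltW// truncnS_gt.
have ndB : nondecreasing_seq (fun n : nat => B n%:R).
  move=> m n mn; apply/subsetPset => x /= /le_trans; apply.
  by rewrite ler_nat.
have := @ge0_nondecreasing_set_cvg_integral _ T R (fun n : nat => B n%:R)
  (fun x => (h (rho x))%:E) mu ndB (fun n => mB _) (fun n => mh (mB _))
  (fun n x _ => hrho0 x).
rewrite BT => lim1.
have lim2 : I n%:R @[n --> \oo] --> (3 * C * l)%:E.
  rewrite (_ : (fun n : nat => I n%:R) = (fun n : nat => (3 * C * H n%:R)%:E)); last first.
    by apply/funext => n; exact: IE.
  apply: cvg_EFin; first by near=> n.
  apply: cvgMr; exact: (cvg_comp _ _ (@cvgr_idn R) Hl).
exact: (cvg_unique _ lim1 lim2).
Unshelve. all: end_near.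
Qed.

End radial_integral.

(** * The coefficients as integrals over R^3 *)

Lemma exp_moment3E (R : realType) (beta : R) (u : R -> R) (k : nat) (l : R) :
  radial_solution 3 beta +oo u -> (k <= 2)%N ->
  radial_moment k u r @[r --> +oo] --> l ->
  exp_moment3 k u = (4 * pi * l)%:E.
Proof.
move=> sol k2 cvgl; have [_ su _ _] := sol.
have ch : continuous (fun r : R => r ^+ k * expR (u r)).
  move=> r; have d : is_derive r 1 u (derive1n 1 u r).
    exact: (@smooth_is_derive R +oo%E u 0 r su (ltry _)).
  have de : is_derive r 1 (fun r => expR (u r)) (expR (u r) * derive1n 1 u r).
    exact: is_derive1_comp.
  exact: is_derive_continuous (is_deriveM (is_derive_exprn k (is_derive_id r 1)) de).
have h0 r : 0 <= r -> 0 <= r ^+ k * expR (u r).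
  by move=> r0; rewrite mulr_ge0 ?expR_ge0 ?exprn_ge0.
rewrite /exp_moment3 /lebesgue3.
pose mu : {measure set _ -> \bar R} :=
  ((@lebesgue_measure R \x @lebesgue_measure R) \x @lebesgue_measure R)%E.
rewrite (@integral_radial _ _ R mu _ _ (@measurable_enorm3 R) (fun x => sqrtr_ge0 _)
  (@lebesgue3_ball R) _ _ ch h0 (@continuous_radial_moment R k u 0 su k2)
  (radial_moment0 k sol) (fun r => is_derive_radial_moment_pos sol k2) _ cvgl).
by congr EFin; move: pi => p; field.
Qed.

Unset Implicit Arguments.

(* The equalities for alpha1, alpha2, alpha3 hold in \bar R, so they also say
   that the three integrals are finite. *)
Theorem theorem1p2 (R : realType) (Rmax : R -> \bar R) (u : R -> R -> R)
    (beta0 : R)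
    (hu : forall beta : R, maximal_radial_solution 3 beta (Rmax beta) (u beta))
    (hbeta0 : separatrix_parameter Rmax u beta0) :
  exists2 c : R, 0 < c &
  exists alpha1 alpha2 alpha3 : R,
    [/\ alpha1%:E = ((- 1 / (8 * pi))%:E * exp_moment3 0 (u beta0))%E,
        alpha2%:E = ((1 / (8 * pi))%:E * exp_moment3 1 (u beta0))%E,
        alpha3%:E = ((- 1 / (24 * pi))%:E * exp_moment3 2 (u beta0))%E &
        exists M : R, \forall r \near +oo,
          `|u beta0 r - (alpha1 * r + alpha2 + alpha3 * r^-1)|
            <= M * expR (- c * r)].
Proof.
have [_ global _] := hbeta0.
have [sol _] := hu beta0; rewrite global// in sol.
have [l [cvgl [c c0 [M hM]]]] := separatrix_expansion sol
  (global_rlift3_le0 sol) (separatrix_rlift3_sup hu hbeta0).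
have pi0 : (pi : R) != 0 by rewrite gt_eqF// pi_gt0.
exists c => //; exists (- (l 0 / 2)), (l 1 / 2), (- (l 2 / 6)); split.
- rewrite (exp_moment3E sol _ (cvgl 0 isT))// -EFinM; congr EFin.
  by move: pi pi0 (l 0) => p p0 l0; field.
- rewrite (exp_moment3E sol _ (cvgl 1 isT))// -EFinM; congr EFin.
  by move: pi pi0 (l 1) => p p0 l1; field.
- rewrite (exp_moment3E sol _ (cvgl 2 isT))// -EFinM; congr EFin.
  by move: pi pi0 (l 2) => p p0 l2; field.
- exists M; near=> r; apply: hM; near: r; exact: nbhs_pinfty_ge.
Unshelve. all: end_near.
Qed.
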